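(* Let $(V,\mathcal Y(z),c,\rho)$ be a graded vertex operator coalgebra with $V_0\nsubseteq\ker c$ and $V_2\nsubseteq\ker\rho$, let $V'$ be its dual vertex operator algebra, and suppose that the higher level Zhu algebras satisfy $\dim A_k(V')<\infty$ for all $k\in\mathbb N$. Then $V$ is corational if and only if $V'$ is a rational vertex operator algebra.
   Context: Conventions: all vector spaces are over $\mathbb C$; $\otimes=\otimes_{\mathbb C}$; $W^*=\mathrm{Hom}(W,\mathbb C)$ and $(\cdot,\cdot)$ is the natural pairing; $\tau(v\otimes w)=w\otimes v$; $V\otimes\mathbb C=\mathbb C\otimes V=V$; $\mathrm{Res}_z$ is the coefficient of $z^{-1}$; $(z_1+z_2)^n=\sum_{i\ge0}\binom{n}{i}z_1^{n-i}z_2^i$; $\delta(x)=\sum_{n\in\mathbb Z}x^n$. Vertex coalgebra: a triple $(V,\mathcal Y(z),c)$ with $V$ a vector space and linear maps $c:V\to\mathbb C$, $\mathcal Y(z):V\to V\otimes V[[z,z^{-1}]]$, $\mathcal Y(z)v=\sum_{k\in\mathbb Z}\Delta_k(v)z^{-k-1}$, such that for all $v\in V$: (i) each $\Delta_k(v)$ is a finite sum (an element of $V\otimes V$) and $\Delta_k(v)=0$ for $k\ll0$; (ii) $(c\otimes\mathrm{Id}_V)\mathcal Y(z)v=v$, $(\mathrm{Id}_V\otimes c)\mathcal Y(z)v\in V[[z]]$ and $\lim_{z\to0}(\mathrm{Id}_V\otimes c)\mathcal Y(z)v=v$; (iii) (Jacobi identity) on $V$, $z_0^{-1}\delta(\frac{z_1-z_2}{z_0})(\mathrm{Id}_V\otimes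 \mathcal Y(z_2))\mathcal Y(z_1)-z_0^{-1}\delta(\frac{z_2-z_1}{-z_0})(\tau\otimes\mathrm{Id}_V)(\mathrm{Id}_V\otimes \mathcal Y(z_1))\mathcal Y(z_2)=z_1^{-1}\delta(\frac{z_2+z_0}{z_1})(\mathcal Y(z_0)\otimes\mathrm{Id}_V)\mathcal Y(z_2)$. It is graded if $V=\oplus_{s\in\mathbb Z}V_s$ with $\dim V_s<\infty$, $V_s=0$ for $s\ll0$, and $\Delta_k(V_s)\subseteq (V\otimes V)_{s+k+1}$, where $(V\otimes V)_t=\oplus_s V_{t-s}\otimes V_s$. Graded vertex operator coalgebra $(V,\mathcal Y(z),c,\rho)$: a graded vertex coalgebra with a linear map $\rho:V\to\mathbb C$ such that, writing $(\rho\otimes\mathrm{Id}_V)\mathcal Y(z)=\sum_{k\in\mathbb Z}L(k)z^{k-2}$, one has $L(k)\in\mathrm{End}(V)$, $[L(k),L(j)]=(k-j)L(k+j)+\frac{k^3-k}{12}\delta_{k+j,0}d$ for some $d\in\mathbb C$, $V_s$ is the eigenspace of $L(0)$ with eigenvalue $s$, and $(L(1)\otimes\mathrm{Id}_V)\mathcal Y(z)=\frac{d}{dz}\mathcal Y(z)$. Weak $V$-comodule: a vector space $\mathcal M$ with a linear map $\mathcal Y_{\mathcal M}(z)=\sum_{k\in\mathbb Z}\Delta_{\mathcal M,k}z^{-k-1}:\mathcal M\to V\otimes\mathcal M[[z,z^{-1}]]$ such that (i) $\Delta_{\mathcal M,k}(m)$ is a finite sum and vanishes for $k\ll0$; (ii)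 $(c\otimes\mathrm{Id}_{\mathcal M})\mathcal Y_{\mathcal M}(z)m=m$; (iii) $z_0^{-1}\delta(\frac{z_1-z_2}{z_0})(\mathrm{Id}_V\otimes \mathcal Y_{\mathcal M}(z_2))\mathcal Y_{\mathcal M}(z_1)-z_0^{-1}\delta(\frac{z_2-z_1}{-z_0})(\tau\otimes\mathrm{Id}_{\mathcal M})(\mathrm{Id}_V\otimes \mathcal Y_{\mathcal M}(z_1))\mathcal Y_{\mathcal M}(z_2)=z_1^{-1}\delta(\frac{z_2+z_0}{z_1})(\mathcal Y(z_0)\otimes\mathrm{Id}_{\mathcal M})\mathcal Y_{\mathcal M}(z_2)$; (iv) writing $(\rho\otimes\mathrm{Id}_{\mathcal M})\mathcal Y_{\mathcal M}(z)=\sum_kL(k)z^{k-2}$, the $L(k)\in\mathrm{End}(\mathcal M)$ satisfy the Virasoro relations above; (v) $(L(1)\otimes\mathrm{Id}_{\mathcal M})\mathcal Y_{\mathcal M}(z)=\frac{d}{dz}\mathcal Y_{\mathcal M}(z)=\mathcal Y_{\mathcal M}(z)L(1)-(\mathrm{Id}_V\otimes L(1))\mathcal Y_{\mathcal M}(z)$. It is admissible if $\mathcal M=\oplus_{t\in\mathbb N}M_t$ with $\Delta_{\mathcal M,k}(M_t)\subseteq\oplus_{s\in\mathbb N}V_{t+k+1-s}\otimes M_s$. An admissible sub comodule is a subspace that is itself an admissible $V$-comodule under the restricted coaction; $\mathcal M$ is simple if it has no nontrivial admissible sub comodule, and cosemisimple (completely reducible) if it is a direct sum of simple admissible sub comodules.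 $V$ is corational if every admissible $V$-comodule is cosemisimple. Dual vertex operator algebra (known, when $V_0\nsubseteq\ker c$, $V_2\nsubseteq\ker\rho$): $V'=\oplus_sV_s^*$ with $\mathbf 1=c|_{V_0}$, $\omega=\rho|_{V_2}$ and $(Y(f,z)g,v)=(f\otimes g,\mathcal Y(z)v)$; $f\in V_s^*$ has weight $\mathrm{wt} f=s$. An admissible module of a vertex operator algebra $\mathcal V$ is a weak module $\mathcal N$ (truncation $u_tw=0$ for $t\gg0$, vacuum $Y_{\mathcal N}(\mathbf 1,z)=\mathrm{Id}$, and the Jacobi identity) with a grading $\mathcal N=\oplus_{s\in\mathbb Z_{\ge0}}N_s$ such that $v_tN_s\subseteq N_{\mathrm{wt} v+s-t-1}$ for homogeneous $v$. $\mathcal V$ is rational if every admissible $\mathcal V$-module is a direct sum of irreducible admissible submodules. Higher level Zhu algebra (Dong–Li–Mason): $A_k(V')=V'/O_k(V')$, where $O_k(V')$ is spanned by all $\mathrm{Res}_z\frac{(1+z)^{\mathrm{wt} f+k}}{z^{2k+2}}Y(f,z)g$ and all $L(-1)f+L(0)f$ ($f$ homogeneous), with product induced by $f*_kg=\sum_{l=0}^k(-1)^l\binom{k+l}{l}\mathrm{Res}_z\frac{(1+z)^{\mathrm{wt} f+k}}{z^{k+l+1}}Y(f,z)g$. *)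

(* Defs.v *)
From HB Require Import structures.
From mathcomp Require Import all_boot all_order all_algebra generic_quotient finmap.
From mathcomp.multinomials Require Import freeg.
From mathcomp Require Import all_classical.

Set Implicit Arguments.
Unset Strict Implicit.
Unset Printing Implicit Defensive.

Import Order.TTheory GRing.Theory Num.Theory.

Local Open Scope classical_set_scope.
Local Open Scope quotient_scope.
Local Open Scope ring_scope.

Section Subspaces.
Context (K : fieldType) (V : lmodType K).
Implicit Types (A G : set V).

Definition is_subspace A :=
  A 0 /\ forall (a : K) u v, A u -> A v -> A (a *: u + v).

Definition linspan G : set V := smallest is_subspace G.

Definition findim A := exists s : seq V, A = linspan [set` s].

Lemma linspan_subspace G : is_subspace (linspan G).
Proof.
split; first by move=> A [[]].
by move=> a u v Gu Gv A /[dup] [[[_ Alin] _]] GA; apply: Alin; [exact: Gu|exact: Gv].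
Qed.

Lemma linspan_ind G (P : V -> Prop) : P 0 ->
  (forall a u v, P u -> P v -> P (a *: u + v)) ->
  (forall x, G x -> P x) -> forall x, linspan G x -> P x.
Proof. by move=> P0 Plin PG x; apply: (smallest_sub (X := P)). Qed.

Lemma subspaceZ A a u : is_subspace A -> A u -> A (a *: u).
Proof. by move=> [A0 Alin] Au; rewrite -[_ *: _]addr0; exact: Alin. Qed.

Lemma subspaceD A u v : is_subspace A -> A u -> A v -> A (u + v).
Proof. by move=> [A0 Alin] Au Av; rewrite -[u]scale1r; exact: Alin. Qed.

End Subspaces.

Section DirectSum.
Context (K : fieldType) (V : lmodType K) (I : choiceType).
Implicit Types (W : I -> set V) (v : V) (x : I -> V).

Definition decomposes W v x :=
  [/\ finite_set [set i | x i != 0], forall i, W i (x i)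
    & v = \sum_(i \in [set: I]) x i].

Definition direct_sum W :=
  (forall i, is_subspace (W i)) /\ (forall v, exists! x, decomposes W v x).

Definition component W i v : V := xget (fun=> 0) (decomposes W v) i.

End DirectSum.

(* The quotient of V by the subspace spanned by G. *)
Section Quotient.
Context (K : fieldType) (V : lmodType K) (G : set V).

Definition quotient_rel (u v : V) : bool := `[< linspan G (u - v) >].

Lemma quotient_rel_refl : reflexive quotient_rel.
Proof. by move=> u; apply/asboolP; rewrite subrr; case: (linspan_subspace G). Qed.

Lemma quotient_rel_sym : symmetric quotient_rel.
Proof.
suff h u v : quotient_rel u v -> quotient_rel v u by move=> u v; apply/idP/idP; exact: h.
move=> /asboolP uv; apply/asboolP; rewrite -opprB -[X in linspan G X]scaleN1r.
exact: subspaceZ (linspan_subspace G) uv.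
Qed.

Lemma quotient_rel_trans : transitive quotient_rel.
Proof.
move=> v u w /asboolP uv /asboolP vw; apply/asboolP.
by rewrite -[u](subrK v) -addrA; apply: subspaceD (linspan_subspace G) uv vw.
Qed.

Canonical quotient_equiv :=
  EquivRel quotient_rel quotient_rel_refl quotient_rel_sym quotient_rel_trans.

Definition quotient := {eq_quot quotient_rel}.

HB.instance Definition _ := Quotient.on quotient.
HB.instance Definition _ := Choice.on quotient.
HB.instance Definition _ : EqQuotient _ quotient_rel quotient :=
  EqQuotient.on quotient.

Definition to_quotient (v : V) : quotient := \pi_quotient v.

Lemma to_quotientP u v :
  to_quotient u = to_quotient v <-> linspan G (u - v).
Proof.
split=> [/eqquotP/asboolP//|uv].
by apply/eqquotP/asboolP.
Qed.

Lemma to_quotient_repr (x : quotient) : to_quotient (repr x) = x.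
Proof. exact: reprK. Qed.

Let q0 : quotient := to_quotient 0.
Let qopp (x : quotient) : quotient := to_quotient (- repr x).
Let qadd (x y : quotient) : quotient := to_quotient (repr x + repr y).
Let qscale (a : K) (x : quotient) : quotient := to_quotient (a *: repr x).

Let repr_pi u : linspan G (repr (to_quotient u) - u).
Proof. by apply/to_quotientP; rewrite to_quotient_repr. Qed.

Let qoppE u : qopp (to_quotient u) = to_quotient (- u).
Proof.
apply/to_quotientP; rewrite -opprD -[X in linspan G X]scaleN1r.
by apply: subspaceZ (linspan_subspace G) _; exact: repr_pi.
Qed.

Let qaddE u v : qadd (to_quotient u) (to_quotient v) = to_quotient (u + v).
Proof.
apply/to_quotientP; rewrite opprD addrACA.
by apply: subspaceD (linspan_subspace G) _ _; exact: repr_pi.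
Qed.

Let qscaleE a u : qscale a (to_quotient u) = to_quotient (a *: u).
Proof.
apply/to_quotientP; rewrite -scalerBr.
by apply: subspaceZ (linspan_subspace G) _; exact: repr_pi.
Qed.

Lemma quotient_ind (P : quotient -> Prop) :
  (forall u, P (to_quotient u)) -> forall x, P x.
Proof. by move=> Pq x; rewrite -(to_quotient_repr x). Qed.

Let qaddA : associative qadd.
Proof.
by move=> x y z; elim/quotient_ind: x => u; elim/quotient_ind: y => v;
  elim/quotient_ind: z => w; rewrite !qaddE addrA.
Qed.
Let qaddC : commutative qadd.
Proof.
by move=> x y; elim/quotient_ind: x => u; elim/quotient_ind: y => v;
  rewrite !qaddE addrC.
Qed.
Let qadd0 : left_id q0 qadd.
Proof. by move=> x; elim/quotient_ind: x => u; rewrite qaddE add0r. Qed.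
Let qaddN : left_inverse q0 qopp qadd.
Proof. by move=> x; elim/quotient_ind: x => u; rewrite qoppE qaddE addNr. Qed.

HB.instance Definition _ := GRing.isZmodule.Build quotient qaddA qaddC qadd0 qaddN.

Let qscaleA a b x : qscale a (qscale b x) = qscale (a * b) x.
Proof. by elim/quotient_ind: x => u; rewrite !qscaleE scalerA. Qed.
Let qscale1 : left_id 1 qscale.
Proof. by move=> x; elim/quotient_ind: x => u; rewrite qscaleE scale1r. Qed.
Let qscaleDr : right_distributive qscale +%R.
Proof.
move=> a x y; elim/quotient_ind: x => u; elim/quotient_ind: y => v.
by rewrite [LHS](congr1 _ (qaddE u v)) [RHS](congr2 qadd (qscaleE a u) (qscaleE a v))
  qscaleE qaddE scalerDr.
Qed.
Let qscaleDl x : {morph qscale^~ x : a b / a + b}.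
Proof.
move=> a b; elim/quotient_ind: x => u.
by rewrite [RHS](congr2 qadd (qscaleE a u) (qscaleE b u)) qscaleE qaddE scalerDl.
Qed.

HB.instance Definition _ := GRing.Zmodule_isLmodule.Build K quotient
  qscaleA qscale1 qscaleDr qscaleDl.

Fact to_quotient_linear : linear to_quotient.
Proof.
by move=> a u v; rewrite -(qaddE (a *: u) v) -(qscaleE a u).
Qed.

HB.instance Definition _ :=
  GRing.isLinear.Build K V quotient *:%R to_quotient to_quotient_linear.

End Quotient.

(* The tensor product: the free vector space on V * W modulo the bilinearity
   relations; [tlift] is its universal property. *)
Section Tensor.
Context (K : fieldType).
Implicit Types V W U : lmodType K.

Notation free V W := {freeg (V * W)%type / K}.
Definition gen V W (v : V) (w : W) : free V W := << (v, w) >>.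

Definition tensor_rel V W : set (free V W) :=
  [set x | (exists a (v v' : V) (w : W),
              x = gen (a *: v + v') w - (a *: gen v w + gen v' w))
        \/ (exists a (v : V) (w w' : W),
              x = gen v (a *: w + w') - (a *: gen v w + gen v w'))].

Definition tensor V W := quotient (@tensor_rel V W).
HB.instance Definition _ V W := GRing.Lmodule.on (tensor V W).

Definition pure V W (v : V) (w : W) : tensor V W :=
  to_quotient (@tensor_rel V W) (gen v w).


Fact pure_bilinear V W : bilinear_for *:%R *:%R (@pure V W).
Proof.
rewrite /pure; split=> [w a v v'|v a w w'];
  rewrite -linearP; apply/to_quotientP; apply: sub_gen_smallest.
  by left; exists a, v, v', w.
by right; exists a, v, w, w'.
Qed.

HB.instance Definition _ V W :=
  bilinear_isBilinear.Build K V W (tensor V W) *:%R *:%R (@pure V W)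
    (@pure_bilinear V W).

HB.instance Definition _ V W (v : V) :=
  GRing.isLinear.Build K W (tensor V W) *:%R (pure v)
    ((@pure_bilinear V W).2 v).

Lemma pureDl V W a (v v' : V) (w : W) :
  pure (a *: v + v') w = a *: pure v w + pure v' w.
Proof. exact: (@pure_bilinear V W).1. Qed.

Lemma pureDr V W a (v : V) (w w' : W) :
  pure v (a *: w + w') = a *: pure v w + pure v w'.
Proof. exact: (@pure_bilinear V W).2. Qed.

Fact fglift_linear (T : choiceType) U (f : T -> U) :
  linear (fglift f : {freeg T / K} -> U).
Proof.
pose F := GRing.isZmodMorphism.Build {freeg T / K} U (fglift f) (lift_is_additive f).
pose g : {additive {freeg T / K} -> U} := HB.pack (fglift f) F.
move=> a D E; change (g (a *: D + E) = a *: g D + g E); rewrite raddfD; congr (_ + _).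
have -> : a *: D = \sum_(x <- dom D) << a * coeff x D *g x >> by [].
rewrite -[in RHS](freeg_sumE D) !raddf_sum.
by apply: eq_bigr => x _; rewrite /= !liftU scalerA.
Qed.

HB.instance Definition _ (T : choiceType) U (f : T -> U) :=
  GRing.isLinear.Build K {freeg T / K} U *:%R (fglift f) (fglift_linear f).

Section Lift.
Context (V W U : lmodType K) (B : {bilinear V -> W -> U}).

Let lift : {linear free V W -> U} := fglift (fun p : (V * W)%type => B p.1 p.2).

Definition tlift (t : tensor V W) : U := lift (repr t).

Let liftE v w : lift (gen v w) = B v w.
Proof. by rewrite /lift /= /gen liftU scale1r. Qed.

Let lift_rel x : linspan (@tensor_rel V W) x -> lift x = 0.
Proof.
move: x; apply: linspan_ind => [|a u v u0 v0|y]; first exact: linear0.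
  by rewrite linearP u0 v0 scaler0 addr0.
case=> [[a [v [v' [w ->]]]]|[a [v [w [w' ->]]]]];
  rewrite linearB linearP !liftE.
  by rewrite linearPl subrr.
by rewrite linearPr subrr.
Qed.

Let tlift_pi x : tlift (to_quotient (@tensor_rel V W) x) = lift x.
Proof.
apply/eqP; rewrite -subr_eq0 /tlift -linearB; apply/eqP/lift_rel.
by apply/to_quotientP; rewrite to_quotient_repr.
Qed.

Fact tlift_linear : linear tlift.
Proof.
move=> a x y; elim/quotient_ind: x => u; elim/quotient_ind: y => v.
by rewrite -linearP !tlift_pi linearP.
Qed.

HB.instance Definition _ :=
  GRing.isLinear.Build K (tensor V W) U *:%R tlift tlift_linear.

Lemma tliftE v w : tlift (pure v w) = B v w.
Proof. by rewrite /pure tlift_pi liftE. Qed.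

End Lift.

Lemma tensor_ind V W (P : tensor V W -> Prop) : P 0 ->
  (forall a u v, P u -> P v -> P (a *: u + v)) ->
  (forall v w, P (pure v w)) -> forall t, P t.
Proof.
move=> P0 Plin Ppure; elim/quotient_ind => D; rewrite -(freeg_sumE D).
elim: (dom D) => [|p s IH]; first by rewrite big_nil linear0.
rewrite big_cons.
suff -> : << coeff p D *g p >> = coeff p D *: gen p.1 p.2 :> free V W.
  by rewrite linearP; apply: Plin => //; exact: Ppure.
case: p => v w; apply/eqP/freeg_eqP => y.
by rewrite coeffZ /gen !coeffU mul1r.
Qed.

Lemma tlift_unique V W U (B : {bilinear V -> W -> U}) (f : {linear tensor V W -> U}) :
  (forall v w, f (pure v w) = B v w) -> f =1 tlift B.
Proof.
move=> fE; elim/tensor_ind => [|a u v fu fv|v w]; first by rewrite !linear0.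
  by rewrite !linearP fu fv.
by rewrite fE tliftE.
Qed.

End Tensor.

Notation "v ⊗ w" := (pure v w) (at level 40, left associativity) : ring_scope.

Section TensorMaps.
Context (K : fieldType).
Implicit Types V W U : lmodType K.

Definition tmap_pre V V' W W' (f : {linear V -> V'}) (g : {linear W -> W'}) v w :
  tensor V' W' := f v ⊗ g w.

Fact tmap_pre_bilinear V V' W W' (f : {linear V -> V'}) (g : {linear W -> W'}) :
  bilinear_for *:%R *:%R (tmap_pre f g).
Proof.
by split=> [w a v v'|v a w w']; rewrite /tmap_pre linearP ?linearPl ?linearPr.
Qed.

HB.instance Definition _ V V' W W' (f : {linear V -> V'}) (g : {linear W -> W'}) :=
  bilinear_isBilinear.Build K V W (tensor V' W') *:%R *:%R (tmap_pre f g)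
    (tmap_pre_bilinear f g).

(* f \otimes g *)
Definition tmap V V' W W' (f : {linear V -> V'}) (g : {linear W -> W'}) :
  {linear tensor V W -> tensor V' W'} := tlift (tmap_pre f g).

Lemma tmapE V V' W W' (f : {linear V -> V'}) (g : {linear W -> W'}) v w :
  tmap f g (v ⊗ w) = f v ⊗ g w.
Proof. exact: tliftE. Qed.

Definition tswap_pre V W (v : V) (w : W) : tensor W V := w ⊗ v.

Fact tswap_pre_bilinear V W : bilinear_for *:%R *:%R (@tswap_pre V W).
Proof.
by split=> [w a v v'|v a w w']; rewrite /tswap_pre ?linearPl ?linearPr.
Qed.

HB.instance Definition _ V W :=
  bilinear_isBilinear.Build K V W (tensor W V) *:%R *:%R (@tswap_pre V W)
    (@tswap_pre_bilinear V W).

Definition tswap V W : {linear tensor V W -> tensor W V} := tlift (@tswap_pre V W).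

(* The associativity isomorphism u \otimes (v \otimes w) |-> (u \otimes v) \otimes w. *)
Definition tassoc_pre V W U (u : U) (t : tensor V W) : tensor (tensor U V) W :=
  tmap (pure u) idfun t.

Fact tassoc_pre_bilinear V W U : bilinear_for *:%R *:%R (@tassoc_pre V W U).
Proof.
split=> [t a u u'|u a t t'] /=; rewrite /tassoc_pre ?linearP //.
elim/tensor_ind: t => [|b s t hs ht|v w]; first by rewrite !linear0 addr0.
  by rewrite 3!(linearP (tmap _ _)) hs ht !scalerDr !scalerA (mulrC a b) addrACA.
by rewrite !tmapE /= !pureDl.
Qed.

HB.instance Definition _ V W U :=
  bilinear_isBilinear.Build K U (tensor V W) (tensor (tensor U V) W) *:%R *:%R
    (@tassoc_pre V W U) (@tassoc_pre_bilinear V W U).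

Definition tassoc U V W :
  {linear tensor U (tensor V W) -> tensor (tensor U V) W} := tlift (@tassoc_pre V W U).

(* f \otimes Id and Id \otimes f for a functional f, with the identifications
   C \otimes W = W = W \otimes C. *)
Definition contractl_pre V W (f : {scalar V}) (v : V) (w : W) : W := f v *: w.
Definition contractr_pre V W (f : {scalar V}) (w : W) (v : V) : W := f v *: w.

Fact contractl_pre_bilinear V W (f : {scalar V}) :
  bilinear_for *:%R *:%R (@contractl_pre V W f).
Proof.
split=> [w a v v'|v a w w']; rewrite /contractl_pre /=.
  by rewrite (linearP f) /= scalerDl -scalerA.
by rewrite scalerDr !scalerA /= (mulrC _ a).
Qed.

Fact contractr_pre_bilinear V W (f : {scalar V}) :
  bilinear_for *:%R *:%R (@contractr_pre V W f).
Proof.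
split=> [v a w w'|w a v v']; rewrite /contractr_pre /=.
  by rewrite scalerDr !scalerA /= (mulrC _ a).
by rewrite (linearP f) /= scalerDl -scalerA.
Qed.

HB.instance Definition _ V W (f : {scalar V}) :=
  bilinear_isBilinear.Build K V W W *:%R *:%R (@contractl_pre V W f)
    (@contractl_pre_bilinear V W f).

HB.instance Definition _ V W (f : {scalar V}) :=
  bilinear_isBilinear.Build K W V W *:%R *:%R (@contractr_pre V W f)
    (@contractr_pre_bilinear V W f).

Definition contractl V W (f : {scalar V}) : {linear tensor V W -> W} :=
  tlift (@contractl_pre V W f).
Definition contractr V W (f : {scalar V}) : {linear tensor W V -> W} :=
  tlift (@contractr_pre V W f).

End TensorMaps.

(* Formal series in several variables are functions from exponents to
   coefficients; the sum below is over all exponents and is meant for products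
   in which every coefficient is a finite sum. *)
Section FormalSeries.
Context (K : numFieldType).

Definition fmul (G : zmodType) (T : lmodType K) (f : G -> K) (A : G -> T) (n : G) : T :=
  \sum_(p \in [set: G]) f p *: A (n - p).

Definition zbin (n j : int) : K :=
  if j is Posz k then (\prod_(i < k) (n - i%:Z))%:~R / (k`!)%:R else 0.

(* The coefficient of x^i y^j in (x + s y)^n, expanded in nonnegative powers of y. *)
Definition zexpand (s : K) (n i j : int) : K :=
  if i + j == n then s ^ j * zbin n j else 0.

(* Exponents of (z_0, z_1, z_2). *)
Notation exp3 := (int * int * int)%type.

(* z_0^-1 delta((z_1 - z_2) / z_0) *)
Definition delta12 (p : exp3) : K := zexpand (-1) (- p.1.1 - 1) p.1.2 p.2.
(* z_0^-1 delta((z_2 - z_1) / (- z_0)) *)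
Definition delta21 (p : exp3) : K :=
  (-1) ^ (- p.1.1 - 1) * zexpand (-1) (- p.1.1 - 1) p.2 p.1.2.
(* z_1^-1 delta((z_2 + z_0) / z_1) *)
Definition delta20 (p : exp3) : K := zexpand 1 (- p.1.2 - 1) p.2 p.1.1.
(* z_2^-1 delta((z_1 - z_0) / z_2) *)
Definition delta10 (p : exp3) : K := zexpand (-1) (- p.2 - 1) p.1.2 p.1.1.

Context (T : lmodType K).

(* \sum_k F k z^(-k-1) *)
Definition ser (F : int -> T) (n : int) : T := F (- n - 1).

(* \sum_(k, l) F k l z_1^(-k-1) z_2^(-l-1) *)
Definition ser12 (F : int -> int -> T) (p : exp3) : T :=
  if p.1.1 == 0 then F (- p.1.2 - 1) (- p.2 - 1) else 0.
(* \sum_(k, l) F k l z_0^(-k-1) z_2^(-l-1) *)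
Definition ser02 (F : int -> int -> T) (p : exp3) : T :=
  if p.1.2 == 0 then F (- p.1.1 - 1) (- p.2 - 1) else 0.

Definition dz (A : int -> T) (n : int) : T := (n + 1)%:~R *: A (n + 1).

Definition residue (A : int -> T) : T := A (-1).

Definition virasoro (L : int -> T -> T) (d : K) : Prop := forall k j x,
  L k (L j x) - L j (L k x) =
    (k - j)%:~R *: L (k + j) x
    + (if k + j == 0 then (k ^+ 3 - k)%:~R / 12%:R * d else 0) *: x.

End FormalSeries.

Section VertexCoalgebras.
Context (K : numFieldType).
Implicit Types V M : lmodType K.

(* \bigoplus_i A_(t - i) \otimes B_i *)
Definition tensor_grade V M (I : Type) (deg : I -> int) (A : int -> set V)
    (B : I -> set M) (t : int) : set (tensor V M) :=
  linspan [set x | exists i v m, [/\ A (t - deg i) v, B i m & x = v ⊗ m]].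

Definition truncated V (T : lmodType K) (Delta : int -> V -> T) : Prop :=
  forall v, exists N : int, forall k, k < N -> Delta k v = 0.

Definition co_jacobi V M (Delta : int -> {linear V -> tensor V V})
    (DeltaM : int -> {linear M -> tensor V M}) : Prop := forall m n,
  fmul (delta12 K)
    (ser12 (fun k l => tassoc V V M (tmap idfun (DeltaM l) (DeltaM k m)))) n
  - fmul (delta21 K)
      (ser12 (fun k l => tmap (tswap V V) idfun
                (tassoc V V M (tmap idfun (DeltaM k) (DeltaM l m))))) n
  = fmul (delta20 K) (ser02 (fun k l => tmap (Delta k) idfun (DeltaM l m))) n.

Record vertex_coalgebra V (Delta : int -> {linear V -> tensor V V})
    (c : {scalar V}) : Prop := VertexCoalgebra {
  vc_truncated : truncated Delta;
  vc_counitl : forall v k, contractl V c (Delta k v) = if k == -1 then v else 0;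
  vc_counitr_reg : forall v k, 0 <= k -> contractr V c (Delta k v) = 0;
  vc_counitr_lim : forall v, contractr V c (Delta (-1) v) = v;
  vc_jacobi : co_jacobi Delta Delta
}.

Record graded_vertex_coalgebra V (gr : int -> set V)
    (Delta : int -> {linear V -> tensor V V}) (c : {scalar V}) : Prop :=
  GradedVertexCoalgebra {
  gvc_coalgebra : vertex_coalgebra Delta c;
  gvc_direct_sum : direct_sum gr;
  gvc_findim : forall s, findim (gr s);
  gvc_bounded : exists N : int, forall s, s < N -> gr s = [set 0];
  gvc_graded : forall k s v, gr s v -> tensor_grade id gr gr (s + k + 1) (Delta k v)
}.

(* (rho \otimes Id) Y_M(z) = \sum_k L(k) z^(k-2), so that L(k) = (rho \otimes Id) Delta_(1-k) *)
Definition coL V M (rho : {scalar V}) (DeltaM : int -> {linear M -> tensor V M})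
  (k : int) : {linear M -> M} := contractl M rho \o DeltaM (1 - k).

(* voc_rank is the constant d of the Virasoro relations. *)
Record gvoc := Gvoc {
  voc_sort :> lmodType K;
  voc_gr : int -> set voc_sort;
  voc_Delta : int -> {linear voc_sort -> tensor voc_sort voc_sort};
  voc_counit : {scalar voc_sort};
  voc_rho : {scalar voc_sort};
  voc_rank : K;
  voc_L := coL voc_rho voc_Delta;
  voc_graded : graded_vertex_coalgebra voc_gr voc_Delta voc_counit;
  voc_virasoro : virasoro voc_L voc_rank;
  voc_eigenspace : forall s, voc_gr s = [set v | voc_L 0 v = s%:~R *: v];
  voc_derivative : forall v n,
    tmap (voc_L 1) idfun (ser (voc_Delta^~ v) n) = dz (ser (voc_Delta^~ v)) n
}.

End VertexCoalgebras.

Arguments voc_gr {K} g s : rename.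
Arguments voc_Delta {K} g k : rename.
Arguments voc_counit {K} g : rename.
Arguments voc_rho {K} g : rename.
Arguments voc_L {K} g k : rename.

Section Comodules.
Context (K : numFieldType) (V : gvoc K).
Implicit Types M N : lmodType K.

Record weak_comodule M (DeltaM : int -> {linear M -> tensor V M}) : Prop :=
  WeakComodule {
  wc_truncated : truncated DeltaM;
  wc_counit : forall m k,
    contractl M (voc_counit V) (DeltaM k m) = if k == -1 then m else 0;
  wc_jacobi : co_jacobi (voc_Delta V) DeltaM;
  wc_virasoro : virasoro (coL (voc_rho V) DeltaM) (voc_rank V);
  wc_derivative : forall m n,
    tmap (voc_L V 1) idfun (ser (DeltaM^~ m) n) = dz (ser (DeltaM^~ m)) n;
  wc_commutator : forall m n,
    let L1 := coL (voc_rho V) DeltaM 1 in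
    dz (ser (DeltaM^~ m)) n =
      ser (DeltaM^~ (L1 m)) n - tmap idfun L1 (ser (DeltaM^~ m) n)
}.

Definition admissible_comodule M (DeltaM : int -> {linear M -> tensor V M}) : Prop :=
  weak_comodule DeltaM /\
  exists gr : nat -> set M, direct_sum gr /\
    forall k t m, gr t m ->
      tensor_grade Posz (voc_gr V) gr (t%:Z + k + 1) (DeltaM k m).

(* The subspace W of M is, under the restricted coaction, the comodule N. *)
Definition is_subcomodule M (DeltaM : int -> {linear M -> tensor V M}) (W : set M)
    N (DeltaN : int -> {linear N -> tensor V N}) : Prop :=
  exists iota : {linear N -> M}, [/\ injective iota, range iota = W &
    forall k n, DeltaM k (iota n) = tmap idfun iota (DeltaN k n)].

Definition admissible_subcomodule M (DeltaM : int -> {linear M -> tensor V M})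
    (W : set M) : Prop :=
  exists N (DeltaN : int -> {linear N -> tensor V N}),
    admissible_comodule DeltaN /\ is_subcomodule DeltaM W DeltaN.

Definition simple_comodule M (DeltaM : int -> {linear M -> tensor V M}) : Prop :=
  [set: M] <> [set 0] /\
  forall W, admissible_subcomodule DeltaM W -> W = [set 0] \/ W = [set: M].

Definition cosemisimple M (DeltaM : int -> {linear M -> tensor V M}) : Prop :=
  exists (I : choiceType) (W : I -> set M), direct_sum W /\
    forall i, exists N (DeltaN : int -> {linear N -> tensor V N}),
      [/\ admissible_comodule DeltaN, simple_comodule DeltaN
        & is_subcomodule DeltaM (W i) DeltaN].

Definition corational : Prop :=
  forall M (DeltaM : int -> {linear M -> tensor V M}),
    admissible_comodule DeltaM -> cosemisimple DeltaM.

End Comodules.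

Section VertexOperatorAlgebras.
Context (K : numFieldType).

(* The data of a vertex operator algebra; voa_Y n f g is the mode f_n g. *)
Record voa_data := VoaData {
  voa_sort :> lmodType K;
  voa_gr : int -> set voa_sort;
  voa_Y : int -> voa_sort -> voa_sort -> voa_sort;
  voa_vacuum : voa_sort;
  voa_omega : voa_sort
}.

Arguments voa_gr : clear implicits.
Arguments voa_vacuum : clear implicits.
Arguments voa_omega : clear implicits.

(* Y(omega, z) = \sum_k L(k) z^(-k-2) *)
Definition voa_L (U : voa_data) (k : int) : U -> U := voa_Y (k + 1) (voa_omega U).

Definition jacobi (U : voa_data) (N : lmodType K) (YN : int -> U -> N -> N) : Prop :=
  forall u v w n,
  fmul (delta12 K) (ser12 (fun k l => YN k u (YN l v w))) n
  - fmul (delta21 K) (ser12 (fun k l => YN l v (YN k u w))) n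
  = fmul (delta10 K) (ser02 (fun k l => YN l (voa_Y k u v) w)) n.

Record weak_module (U : voa_data) (N : lmodType K) (YN : int -> U -> N -> N) : Prop :=
  WeakModule {
  wm_bilinear : forall k, bilinear_for *:%R *:%R (YN k);
  wm_truncated : forall u w, exists T : int, forall t, T <= t -> YN t u w = 0;
  wm_vacuum : forall w k, YN k (voa_vacuum U) w = if k == -1 then w else 0;
  wm_jacobi : jacobi YN
}.

Record is_voa (U : voa_data) : Prop := IsVoa {
  voa_direct_sum : direct_sum (voa_gr U);
  voa_findim : forall s, findim (voa_gr U s);
  voa_bounded : exists N : int, forall s, s < N -> voa_gr U s = [set 0];
  voa_adjoint : weak_module (@voa_Y U);
  voa_creation_reg : forall (u : U) k, 0 <= k -> voa_Y k u (voa_vacuum U) = 0;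
  voa_creation_lim : forall u : U, voa_Y (-1) u (voa_vacuum U) = u;
  voa_vacuum_gr : voa_gr U 0 (voa_vacuum U);
  voa_omega_gr : voa_gr U 2 (voa_omega U);
  voa_virasoro : exists d, virasoro (@voa_L U) d;
  voa_L0 : forall s (u : U), voa_gr U s u -> voa_L 0 u = s%:~R *: u;
  voa_derivative : forall (u v : U) n,
    ser (fun k => voa_Y k (voa_L (-1) u) v) n = dz (ser (fun k => voa_Y k u v)) n
}.

Definition int_ext (N : lmodType K) (gr : nat -> set N) (s : int) : set N :=
  if s is Posz t then gr t else [set 0].

Definition admissible_module (U : voa_data) (N : lmodType K) (YN : int -> U -> N -> N) : Prop :=
  weak_module YN /\
  exists gr : nat -> set N, direct_sum gr /\
    forall r t s v w, voa_gr U r v -> gr s w ->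
      int_ext gr (r + s%:Z - t - 1) (YN t v w).

Definition is_submodule (U : voa_data) (M : lmodType K) (YM : int -> U -> M -> M)
    (W : set M) (N : lmodType K) (YN : int -> U -> N -> N) : Prop :=
  exists iota : {linear N -> M}, [/\ injective iota, range iota = W &
    forall k u n, YM k u (iota n) = iota (YN k u n)].

Definition admissible_submodule (U : voa_data) (M : lmodType K)
    (YM : int -> U -> M -> M) (W : set M) : Prop :=
  exists (N : lmodType K) (YN : int -> U -> N -> N),
    admissible_module YN /\ is_submodule YM W YN.

Definition irreducible_module (U : voa_data) (M : lmodType K)
    (YM : int -> U -> M -> M) : Prop :=
  [set: M] <> [set 0] /\
  forall W, admissible_submodule YM W -> W = [set 0] \/ W = [set: M].

Definition completely_reducible (U : voa_data) (M : lmodType K)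
    (YM : int -> U -> M -> M) : Prop :=
  exists (I : choiceType) (W : I -> set M), direct_sum W /\
    forall i, exists (N : lmodType K) (YN : int -> U -> N -> N),
      [/\ admissible_module YN, irreducible_module YN & is_submodule YM (W i) YN].

Definition rational_voa (U : voa_data) : Prop :=
  is_voa U /\
  forall (M : lmodType K) (YM : int -> U -> M -> M),
    admissible_module YM -> completely_reducible YM.

(* The spanning set of O_k(U); the series fun n => zbin e (n + m) is
   (1 + z)^e / z^m. *)
Definition zhu_gen (U : voa_data) (k : nat) : set U := [set x |
     (exists s f g, voa_gr U s f /\
        x = residue (fmul (fun n => zbin K (s + k%:Z) (n + (2 * k + 2)%N%:Z))
                          (ser (fun l => voa_Y l f g))))
  \/ (exists s f, voa_gr U s f /\ x = voa_L (-1) f + voa_L 0 f)].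

(* A_k(U) = U / O_k(U) *)
Definition zhu (U : voa_data) (k : nat) : lmodType K := quotient (@zhu_gen U k).

End VertexOperatorAlgebras.

Section RestrictedDual.
Context (K : numFieldType) (V : lmodType K) (gr : int -> set V).

(* \bigoplus_s V_s^*, as the functionals on V that vanish on all but finitely
   many V_s. *)
Definition gdual_pred : {pred V -> K^o} := fun f =>
  `[< linear f /\ finite_set [set s | exists2 v, gr s v & f v != 0] >].

Fact gdual_pred_closed : submod_closed gdual_pred.
Proof.
split=> [|a f g /asboolP[lf ff] /asboolP[lg fg]].
  apply/asboolP; split; first by move=> a u v; rewrite /= scaler0 addr0.
  by apply: (sub_finite_set _ (finite_set0 int)) => s [v _ /eqP].
apply/asboolP; split=> [b u v|].
  by rewrite !fctE /= lf lg !scalerDr !scalerA (mulrC a b) addrACA.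
apply: (sub_finite_set (B := _ `|` _) _ (_ : finite_set _)); last first.
  by rewrite finite_setU; split; [exact: ff|exact: fg].
move=> s [v sv /= fgv].
have [f0|f0] := eqVneq (f v) 0; last by left; exists v.
right; exists v => //; apply: contra_neq fgv => g0.
by rewrite !fctE /= f0 g0 scaler0 addr0.
Qed.

HB.instance Definition _ := GRing.isSubmodClosed.Build K (V -> K^o) gdual_pred
  gdual_pred_closed.

Record gdual := Gdual { gdual_fun :> V -> K^o; gdual_funP : gdual_fun \in gdual_pred }.

HB.instance Definition _ := [isSub for gdual_fun].
HB.instance Definition _ := [Choice of gdual by <:].
HB.instance Definition _ := [SubChoice_isSubLmodule of gdual by <:].

Fact gdual_linear (f : gdual) : linear_for *%R (f : V -> K).
Proof. by have /asboolP[] := gdual_funP f. Qed.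

HB.instance Definition _ (f : gdual) :=
  GRing.isLinear.Build K V K *%R (f : V -> K) (gdual_linear f).

Fact gdual_finite (f : gdual) : finite_set [set s | exists2 v, gr s v & f v != 0].
Proof. by have /asboolP[] := gdual_funP f. Qed.

(* V_s^* inside \bigoplus_s V_s^* *)
Definition gdual_gr (s : int) : set gdual :=
  [set f | forall t v, t != s -> gr t v -> f v = 0].

End RestrictedDual.

Section DirectSumTheory.
Context (K : fieldType) (V : lmodType K) (I : choiceType) (W : I -> set V).
Context (dsW : direct_sum W).

Lemma componentP v : decomposes W v (component W ^~ v).
Proof.
have [x [dx _]] := dsW.2 v.
by have := xgetPex (fun=> 0) (ex_intro (decomposes W v) x dx).
Qed.

Lemma component_unique v x : decomposes W v x -> component W ^~ v = x.
Proof.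
move=> dx; have [y [_ yu]] := dsW.2 v.
by rewrite -(yu _ dx) -(yu _ (componentP v)).
Qed.

Lemma decomposesP a u v x y : decomposes W u x -> decomposes W v y ->
  decomposes W (a *: u + v) (fun i => a *: x i + y i).
Proof.
move=> [fx Wx ->] [fy Wy ->]; pose A := fset_set ([set i | x i != 0] `|` [set i | y i != 0]).
have fxy : finite_set ([set i | x i != 0] `|` [set i | y i != 0]).
  by rewrite finite_setU.
have memA i : i \notin A -> x i = 0 /\ y i = 0.
  rewrite in_fset_set // => /negP; rewrite inE /= => /not_orP[nx ny].
  by split; [move: nx|move: ny] => /negP; rewrite negbK => /eqP.
split.
- apply: (sub_finite_set _ fxy) => i /=; have [->|] := eqVneq (x i) 0; last by left.
  by rewrite scaler0 add0r; right.
- by move=> i; apply: (dsW.1 i).2.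
- rewrite !(fsbigTE A); first by rewrite scaler_sumr -big_split.
  all: move=> i /memA[x0 y0] //.
  by rewrite x0 y0 scaler0 addr0.
Qed.

Lemma component_linear i : linear (component W i).
Proof.
move=> a u v.
by rewrite -[LHS]/((component W ^~ _) i)
  (component_unique (decomposesP a (componentP u) (componentP v))).
Qed.

Lemma component_homog i v : W i v ->
  component W ^~ v = (fun j => if j == i then v else 0).
Proof.
move=> Wv; apply: component_unique; split.
- by apply: (sub_finite_set _ (finite_set1 i)) => j /=; case: (j =P i); rewrite ?eqxx.
- by move=> j; case: (j =P i) => [->//|_]; case: (dsW.1 j).
- rewrite (fsbigTE [fset i]%fset) ?big_seq_fset1 ?eqxx // => j.
  by rewrite inE => /negbTE ->.
Qed.

End DirectSumTheory.

Section DualData.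
Context (K : numFieldType).

Definition tpair_pre (V W : lmodType K) (f : {scalar V}) (g : {scalar W}) v w : K^o :=
  f v * g w.

Fact tpair_pre_bilinear (V W : lmodType K) (f : {scalar V}) (g : {scalar W}) :
  bilinear_for *:%R *:%R (tpair_pre f g).
Proof.
split=> [w a v v'|v a w w']; rewrite /tpair_pre /=.
  by rewrite (linearP f) /= mulrDl -mulrA.
by rewrite (linearP g) /= mulrDr mulrCA.
Qed.

HB.instance Definition _ (V W : lmodType K) (f : {scalar V}) (g : {scalar W}) :=
  bilinear_isBilinear.Build K V W K^o *:%R *:%R (tpair_pre f g)
    (tpair_pre_bilinear f g).

(* (f \otimes g, -) *)
Definition tpair (V W : lmodType K) (f : {scalar V}) (g : {scalar W}) :
  {linear tensor V W -> K^o} := tlift (tpair_pre f g).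

Lemma tpairE (V W : lmodType K) (f : {scalar V}) (g : {scalar W}) v w :
  tpair f g (v ⊗ w) = f v * g w.
Proof. exact: tliftE. Qed.

Context (V : gvoc K).
Notation V' := (gdual (voc_gr V)).

(* (f_n g, v) = (f \otimes g, Delta_n v) *)
Definition dual_mode_fun (n : int) (f g : V') (v : V) : K^o :=
  tpair f g (voc_Delta V n v).

Fact dual_mode_proof n f g : dual_mode_fun n f g \in gdual_pred (voc_gr V).
Proof.
apply/asboolP; split=> [a u v|]; first by rewrite /dual_mode_fun !linearP.
have := finite_image2 (fun a b : int => a + b - n - 1)
  (gdual_finite f) (gdual_finite g).
apply: sub_finite_set => s [v sv /=]; apply: contraNP => ns; apply/eqP.
move: (gvc_graded (voc_graded V) (k := n) sv).
apply: (linspan_ind (P := fun t => tpair f g t = 0)).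
- by rewrite linear0.
- by move=> a t t' t0 t0'; rewrite linearP t0 t0' scaler0 addr0.
- move=> t [i [x [y [sx sy ->]]]]; rewrite tpairE; apply/eqP/contraT => xy; case: ns.
  move: xy; rewrite mulf_eq0 negb_or => /andP[x0 y0].
  exists (s + n + 1 - i); first by exists x.
  exists i; first by exists y.
  by rewrite subrK (addrAC _ 1) !addrK.
Qed.

Definition dual_mode n f g : V' := Gdual (dual_mode_proof n f g).

(* f|_{V_s}, extended by 0 to the other V_t *)
Definition restrict_fun (s : int) (f : {scalar V}) (v : V) : K^o :=
  f (component (voc_gr V) s v).

Fact restrict_proof s f : restrict_fun s f \in gdual_pred (voc_gr V).
Proof.
have ds := gvc_direct_sum (voc_graded V).
apply/asboolP; split=> [a u v|].
  by rewrite /restrict_fun (component_linear ds) (linearP f).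
apply: (sub_finite_set _ (finite_set1 s)) => t [v tv]; apply: contra_neqP => ts.
rewrite /restrict_fun.
by have /(congr1 (@^~ s)) -> := component_homog ds tv; rewrite eq_sym (introF eqP ts) linear0.
Qed.

Definition restrict s f : V' := Gdual (restrict_proof s f).

Definition dual_voa : voa_data K := {|
  voa_sort := V';
  voa_gr := @gdual_gr K V (voc_gr V);
  voa_Y := dual_mode;
  voa_vacuum := restrict 0 (voc_counit V);
  voa_omega := restrict 2 (voc_rho V)
|}.

End DualData.

(* Main.v *)
From HB Require Import structures.
Require Import Defs.
From mathcomp Require Import all_boot all_order all_algebra finmap.
From mathcomp Require Import all_classical reals.
From mathcomp.real_closed Require Import complex.
From mathcomp Require Import zify ring.

(** The two semisimplicity conditions coincide because an admissible V-comodule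
    and an admissible V'-module are the same structure on the same vector space.

    A coaction on M is determined by its modes f_k = (f \otimes Id) Delta_k, for f
    in V'. As every V_s is finite dimensional and V is bounded below, a graded
    family of such modes conversely assembles to a coaction, by means of dual
    bases of the V_s (coaction_admissible). Contracting the co-Jacobi identity
    gives Borcherds' identity for the modes, with the order of composition
    reversed (comode_borcherds): M is a right module over V'.

    Right modules become left modules through the involution
    e^(L(1)) (-1)^(L(0)) of V'. For f of weight r the mode f_k is replaced by

      (-1)^r \sum_j (L(1)^j f / j!)_(2r - k - 2 - j),

    which is the formula for the contragredient module, applied on M itself
    instead of its dual. That Borcherds' identity is carried over
    (twist_borcherds_homog) is a computation inside V': the commutator of L(1)
    with modes is integrated to the conjugation formula for e^(xL(1))
    (divpow_mode), and the change of variable z |-> - z / (1 + z) amounts to the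
    Chu-Vandermonde identity (zbin_conv). The construction is involutive (twistK)
    and preserves gradings (twist_graded).

    A linear map commutes with coactions exactly when it commutes with the
    corresponding actions (subcomoduleP). Hence subobjects, simplicity and
    decompositions into simple subobjects agree on the two sides
    (cosemisimpleP). The remaining axioms of a comodule, the Virasoro relations
    and the two formulas for the derivative, follow from Borcherds' identity for
    the conformal vector. That V' is a vertex operator algebra (dual_is_voa)
    uses that the counit has degree 0 and rho has degree 2 (counit_restrict,
    rho_restrict). *)

Set Implicit Arguments.
Unset Strict Implicit.
Unset Printing Implicit Defensive.

Import Order.TTheory GRing.Theory Num.Theory.

Local Open Scope classical_set_scope.
Local Open Scope ring_scope.

(** * Linear functions and eventually zero sums *)

Arguments zbin : simpl never.

Section LinearFunctions.
Context (K : pzRingType) (V W : lmodType K) (f : V -> W).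
Hypothesis lf : linear f.

Let g : {linear V -> W} := HB.pack f (GRing.isLinear.Build K V W *:%R f lf).

Lemma lin0 : f 0 = 0. Proof. exact: (linear0 g). Qed.
Lemma linD u v : f (u + v) = f u + f v. Proof. exact: (linearD g). Qed.
Lemma linB u v : f (u - v) = f u - f v. Proof. exact: (linearB g). Qed.
Lemma linZ a u : f (a *: u) = a *: f u. Proof. exact: (linearZ_LR g). Qed.
Lemma lin_sum I r (P : pred I) F :
  f (\sum_(i <- r | P i) F i) = \sum_(i <- r | P i) f (F i).
Proof. exact: (linear_sum g). Qed.

End LinearFunctions.

Section EventuallyZeroSums.
Context (K : pzRingType) (T : lmodType K).
Implicit Types F G : nat -> T.

Definition nsum F : T := \sum_(i \in [set: nat]) F i.
(** By truncation the sums over exponents below are of this kind; a sum with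
    infinitely many nonzero terms is 0 by convention, which linear operations do
    not respect. *)
Definition eventually0 F := exists n, forall i, (n <= i)%N -> F i = 0.

Lemma nsumE n F : (forall i, (n <= i)%N -> F i = 0) -> nsum F = \sum_(i < n) F i.
Proof.
move=> F0; rewrite fsbig_ord /nsum; symmetry; apply: fsbig_widen => // i /= [_].
by move=> /negP; rewrite -leqNgt => /F0.
Qed.

Lemma eq_nsum F G : F =1 G -> nsum F = nsum G.
Proof. by move=> FG; apply: eq_fsbigr => i _; exact: FG. Qed.

Lemma nsum0 F : (forall i, F i = 0) -> nsum F = 0.
Proof. by move=> F0; rewrite (nsumE (n := 0)) ?big_ord0. Qed.

Lemma eventually0_pair F G : eventually0 F -> eventually0 G ->
  exists n, forall i, (n <= i)%N -> F i = 0 /\ G i = 0.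
Proof.
move=> [n Fn] [m Gm]; exists (maxn n m) => i.
by rewrite geq_max => /andP[/Fn -> /Gm ->].
Qed.

Lemma nsumP (a : K) F G : eventually0 F -> eventually0 G ->
  nsum (fun i => a *: F i + G i) = a *: nsum F + nsum G.
Proof.
move=> /eventually0_pair /[apply] -[n FG0].
rewrite !(nsumE (n := n)) ?scaler_sumr -?big_split // => i /FG0[F0 G0] //.
by rewrite F0 G0 scaler0 addr0.
Qed.

Lemma nsumZ (a : K) F : eventually0 F -> nsum (fun i => a *: F i) = a *: nsum F.
Proof.
move=> Fz; rewrite -[RHS]addr0 -(@nsum0 (fun=> 0)) // -nsumP //; last by exists 0%N.
by apply: eq_nsum => i; rewrite addr0.
Qed.

Lemma eventually0_scale (c : nat -> K) F : eventually0 F -> eventually0 (fun i => c i *: F i).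
Proof. by move=> [n F0]; exists n => i /F0 ->; rewrite scaler0. Qed.

Lemma eventually0_sum n (H : nat -> nat -> T) : (forall j, eventually0 (H j)) ->
  eventually0 (fun i => \sum_(j < n) H j i).
Proof.
move=> Hz; elim: n => [|n [m Hm]]; first by exists 0%N => i; rewrite big_ord0.
have [p Hp] := Hz n; exists (maxn m p) => i.
by rewrite geq_max big_ord_recr => /andP[/Hm -> /Hp ->]; rewrite /= addr0.
Qed.

Lemma nsum_sum n (H : nat -> nat -> T) : (forall j, eventually0 (H j)) ->
  nsum (fun i => \sum_(j < n) H j i) = \sum_(j < n) nsum (H j).
Proof.
move=> Hz; elim: n => [|n IH].
  by rewrite big_ord0 nsum0 // => i; rewrite big_ord0.
rewrite big_ord_recr -IH /= -[X in X + _]scale1r.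
rewrite -(nsumP _ (eventually0_sum n Hz) (Hz n)); apply: eq_nsum => i.
by rewrite big_ord_recr scale1r.
Qed.

Lemma nsum_shift0 F : (forall i, F i.+1 = 0) -> nsum F = F 0%N.
Proof.
by move=> F0; rewrite (nsumE (n := 1)) ?big_ord1 // => -[].
Qed.

Lemma nsum_single p F : (forall i, i <> p -> F i = 0) -> nsum F = F p.
Proof.
move=> F0; rewrite (nsumE (n := p.+1)).
  by rewrite big_ord_recr /= big1 ?add0r // => -[i ip] _; apply: F0 => /=; lia.
by move=> i pi; apply: F0; lia.
Qed.

Lemma nsum_delta (a : nat -> K) F (x : int) :
  nsum (fun j => a j *: (if j%:Z == x then F j else 0))
  = if x is Posz p then a p *: F p else 0.
Proof.
case: x => p; last by rewrite nsum0 // => j; rewrite scaler0.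
rewrite (nsum_single (p := p)) ?eqxx // => j jp.
by rewrite eqz_nat (introF eqP jp) scaler0.
Qed.

End EventuallyZeroSums.

Lemma nsum_lin (K : pzRingType) (S T : lmodType K) (f : S -> T) (F : nat -> S) :
  linear f -> eventually0 F -> f (nsum F) = nsum (fun i => f (F i)).
Proof.
move=> lf [n F0]; rewrite !(nsumE (n := n)) ?lin_sum // => i /F0 -> //.
exact: lin0.
Qed.

(** * Binomial coefficients *)

Section Binomials.
Context (K : numFieldType).
Local Notation zb := (zbin K).


Lemma zbin0 n : zb n 0 = 1.
Proof. by rewrite /zbin /= big_ord0 fact0 divr1. Qed.

Lemma zbin_neg n j : j < 0 -> zb n j = 0.
Proof. by case: j. Qed.

Lemma zbinS n (i : nat) : (i.+1)%:R * zb n i.+1%:Z = (n - i%:Z)%:~R * zb n i%:Z.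
Proof.
have f0 (k : nat) : (k`!)%:R != 0 :> K by rewrite pnatr_eq0 -lt0n fact_gt0.
rewrite /zbin big_ord_recr /= rmorphM factS natrM /=.
have i0 : (i.+1)%:R != 0 :> K by rewrite pnatr_eq0.
by move: i0 (f0 i); move: (i.+1)%:R (i`!)%:R => c d c0 d0; field; rewrite ?c0 ?d0.
Qed.

Lemma zbin_eq n (i : nat) : zb n i.+1%:Z = (n - i%:Z)%:~R / (i.+1)%:R * zb n i%:Z.
Proof.
have i0 : (i.+1)%:R != 0 :> K by rewrite pnatr_eq0.
apply: (mulfI i0); rewrite zbinS; move: (zb n i) (_%:~R) => x y.
by rewrite mulrA [X in _ = X * _]mulrC divfK.
Qed.

Lemma zbin1 n : zb n 1 = n%:~R.
Proof. by rewrite (zbin_eq n 0) zbin0 subr0 divr1 mulr1. Qed.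

Lemma zbin0l (j : nat) : zb 0 j.+1%:Z = 0.
Proof.
by elim: j => [|j IH]; rewrite zbin_eq ?zbin0 ?IH ?mulr0 // subrr mul0r mul0r.
Qed.

Lemma zbin_pascal n (i : nat) : zb (n + 1) i.+1%:Z = zb n i.+1%:Z + zb n i%:Z.
Proof.
elim: i => [|i IH].
  by rewrite !zbin1 zbin0 rmorphD.
have i0 (k : nat) : (k.+1)%:R != 0 :> K by rewrite pnatr_eq0.
apply: (mulfI (i0 i.+1)); rewrite mulrDr !zbinS IH.
have := zbinS n i; set x := zb n i.+1; set y := zb n i => xy.
have -> : (n + 1 - i.+1%:Z)%:~R = (n - i%:Z)%:~R :> K by congr (_%:~R); lia.
rewrite mulrDr -xy -mulrDl -[RHS]mulrDl; congr (_ * _).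
rewrite !rmorphB /= -!natr1; ring.
Qed.

(** This turns z_2^-1 delta((z_1 - z_0) / z_2) into
    z_1^-1 delta((z_2 + z_0) / z_1). *)
Lemma zbin_reflect n (j : nat) : (-1) ^+ j * zb (j%:Z - 1 - n) j%:Z = zb n j%:Z.
Proof.
rewrite /zbin /= mulrA; congr (_ / _).
have {1}-> : (-1) ^+ j = ((-1) ^+ j : int)%:~R :> K by rewrite rmorphXn rmorphN1.
rewrite -rmorphM /=; congr (_%:~R).
rewrite (reindex_inj rev_ord_inj) /=.
transitivity ((-1) ^+ j * \prod_(i < j) - (n - i%:Z)).
  by congr (_ * _); apply: eq_bigr => i _; have := ltn_ord i; lia.
by rewrite prodrN card_ord mulrA -expr2 sqrr_sign mul1r.
Qed.

Lemma zbin_small (m j : nat) : (m < j)%N -> zb m%:Z j%:Z = 0.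
Proof.
case: j => // j; elim: j => [|j IH] mj.
  have -> : m = 0%N by lia.
  exact: zbin0l.
rewrite zbin_eq; have [->|/IH ->] : m = j.+1 \/ (m < j.+1)%N by lia.
  by rewrite subrr mul0r mul0r.
by rewrite mulr0.
Qed.

(** The expansion of (1 - z)^-2. *)
Lemma zbinN2 (j : nat) : (-1) ^+ j * zb (-2) j%:Z = (j.+1)%:R.
Proof.
elim: j => [|j IH]; first by rewrite zbin0 mulr1.
have j0 : (j.+1)%:R != 0 :> K by rewrite pnatr_eq0.
rewrite zbin_eq exprS.
transitivity ((- (-2 - j%:Z)%:~R) / (j.+1)%:R * ((-1) ^+ j * zb (-2) j%:Z)); first by ring.
rewrite IH divfK // -rmorphN -[RHS]/((j.+2%:Z)%:~R) /=; congr (_%:~R); lia.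
Qed.

(** Chu-Vandermonde, in the form that the change of variable
    z |-> - z / (1 + z) produces. By induction on s and Pascal's rule both sides
    change by the same amount from x to x + 1, so x = 0 decides. *)
Lemma zbin_conv x y (s : nat) :
  \sum_(i < s.+1) (-1) ^+ i * zb x i%:Z * zb (y - i%:Z) (s - i)%N%:Z
    = zb (y - x) s%:Z.
Proof.
elim: s x y => [|s IH] x y; first by rewrite big_ord1 !zbin0 expr0 !mul1r.
pose S x := \sum_(i < s.+2) (-1) ^+ i * zb x i%:Z * zb (y - i%:Z) (s.+1 - i)%N%:Z.
have S1 z : S (z + 1) = S z - zb (y - 1 - z) s%:Z.
  rewrite -IH /S !(big_ord_recl s.+1) /= !zbin0 -addrA; congr (_ + _).
  rewrite -sumrB; apply: eq_bigr => i _; rewrite /bump /= !add1n zbin_pascal.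
  rewrite subSS (_ : y - 1 - i%:Z = y - i.+1%:Z); last by lia.
  by rewrite exprS; ring.
have S2 z : zb (y - (z + 1)) s.+1%:Z = zb (y - z) s.+1%:Z - zb (y - 1 - z) s%:Z.
  have -> : y - z = y - (z + 1) + 1 by lia.
  have -> : y - 1 - z = y - (z + 1) by lia.
  by rewrite zbin_pascal addrK.
rewrite -/(S x); elim/int_rec: x => [|n IHn|n IHn].
- rewrite /S big_ord_recl big1 ?addr0 => [|i _]; last by rewrite zbin0l mulr0 mul0r.
  by rewrite /= zbin0 expr0 !mul1r; congr (zb _ _); lia.
- by rewrite -addn1 PoszD S1 S2 IHn.
- have e : - n%:Z = - n.+1%:Z + 1 by lia.
  by move: IHn; rewrite e S1 S2 => /addIr.
Qed.

Lemma signB (x : int) (i : nat) : (-1 : K) ^ (x - i%:Z) = (-1) ^ x * (-1) ^+ i.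
Proof.
rewrite expfzDr; last by rewrite oppr_eq0 oner_eq0.
by rewrite -exprnN -exprVn invrN1.
Qed.

Lemma alternating_binomials (p : nat) :
  \sum_(j < p.+2) (-1) ^+ j * 'C(p.+1, j)%:R = 0 :> K.
Proof.
have := exprDn (1 : K) (-1) p.+1; rewrite subrr expr0n /= => e; symmetry.
by rewrite [LHS]e; apply: eq_bigr => j _; rewrite expr1n mul1r mulr_natr.
Qed.

End Binomials.

(** * The Jacobi identity coefficient by coefficient *)

Section JacobiCoefficients.
Context (K : numFieldType) (T : lmodType K).
Implicit Types A B C : int -> int -> T.

Lemma fmul_nsum (G : zmodType) (f : G -> K) (F : G -> T) n (h : nat -> G) :
  injective h -> (forall p, ~ range h p -> f p *: F (n - p) = 0) ->
  fmul f F n = nsum (fun j => f (h j) *: F (n - h j)).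
Proof.
move=> hI h0; transitivity (\sum_(p \in range h) f p *: F (n - p)); last first.
  by rewrite fsbig_image // => ? ? _ _ /hI.
by symmetry; apply: fsbig_widen => // p /= [_ /h0].
Qed.

(** The exponents (- n - 1, - m - 1, - k - 1) of z_0, z_1, z_2 are those of the
   coefficient of z_0^(-n-1) z_1^(-m-1) z_2^(-k-1). *)
Lemma fmul_delta12 A n m k :
  fmul (delta12 K) (ser12 A) (- n - 1, - m - 1, - k - 1)
  = nsum (fun j : nat => ((-1) ^+ j * zbin K n j) *: A (m + n - j%:Z) (k + j%:Z)).
Proof.
rewrite (fmul_nsum (h := fun j : nat => (- n - 1, n - j%:Z, j%:Z))).
- apply: eq_nsum => j; rewrite /delta12 /zexpand /ser12 /= subrr eqxx.
  rewrite (_ : n - j%:Z + j%:Z == _); last by apply/eqP; lia.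
  by rewrite (_ : - (- n - 1) - 1 = n);
    [congr (_ *: A _ _); lia|lia].
- by move=> i j [].
- move=> [[p0 p1] p2] np; rewrite /delta12 /zexpand /ser12 /=.
  case: ifP => [/eqP e1|_]; last by rewrite scale0r.
  case: ifP => [/eqP e2|_]; last by rewrite scaler0.
  case: p2 e1 np => [j|j] e1 np; last by rewrite zbin_neg // mulr0 scale0r.
  by case: np; exists j => //; congr (_, _, _); lia.
Qed.

Lemma fmul_delta21 A n m k :
  fmul (delta21 K) (ser12 A) (- n - 1, - m - 1, - k - 1)
  = nsum (fun j : nat => ((-1) ^ n * ((-1) ^+ j * zbin K n j)) *:
                           A (m + j%:Z) (k + n - j%:Z)).
Proof.
rewrite (fmul_nsum (h := fun j : nat => (- n - 1, j%:Z, n - j%:Z))).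
- apply: eq_nsum => j; rewrite /delta21 /zexpand /ser12 /= subrr eqxx.
  rewrite (_ : n - j%:Z + j%:Z == _); last by apply/eqP; lia.
  by rewrite (_ : - (- n - 1) - 1 = n);
    [congr (_ *: A _ _); lia|lia].
- by move=> i j [].
- move=> [[p0 p1] p2] np; rewrite /delta21 /zexpand /ser12 /=.
  case: ifP => [/eqP e1|_]; last by rewrite mulr0 scale0r.
  case: ifP => [/eqP e2|_]; last by rewrite scaler0.
  case: p1 e1 np => [j|j] e1 np; last by rewrite zbin_neg // !mulr0 scale0r.
  by case: np; exists j => //; congr (_, _, _); lia.
Qed.

Lemma fmul_delta20 A n m k :
  fmul (delta20 K) (ser02 A) (- n - 1, - m - 1, - k - 1)
  = nsum (fun j : nat => zbin K m j *: A (n + j%:Z) (k + m - j%:Z)).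
Proof.
rewrite (fmul_nsum (h := fun j : nat => (j%:Z, - m - 1, m - j%:Z))).
- apply: eq_nsum => j; rewrite /delta20 /zexpand /ser02 /= subrr eqxx.
  rewrite (_ : m - j%:Z + j%:Z == _); last by apply/eqP; lia.
  rewrite (_ : - (- m - 1) - 1 = m); last lia.
  by rewrite exp1rz mul1r; congr (_ *: A _ _); lia.
- by move=> i j [].
- move=> [[p0 p1] p2] np; rewrite /delta20 /zexpand /ser02 /=.
  case: ifP => [/eqP e1|_]; last by rewrite scale0r.
  case: ifP => [/eqP e2|_]; last by rewrite scaler0.
  case: p0 e1 np => [j|j] e1 np; last by rewrite zbin_neg // mulr0 scale0r.
  by case: np; exists j => //; congr (_, _, _); lia.
Qed.

Lemma fmul_delta10 A n m k :
  fmul (delta10 K) (ser02 A) (- n - 1, - m - 1, - k - 1)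
  = nsum (fun j : nat => zbin K m j *: A (n + j%:Z) (k + m - j%:Z)).
Proof.
rewrite (fmul_nsum (h := fun j : nat => (j%:Z, - m - 1, m - j%:Z))).
- apply: eq_nsum => j; rewrite /delta10 /zexpand /ser02 /= subrr eqxx.
  rewrite (_ : - m - 1 + j%:Z == _); last by apply/eqP; lia.
  rewrite (_ : - (m - j%:Z) - 1 = j%:Z - 1 - m); last lia.
  by rewrite zbin_reflect; congr (_ *: A _ _); lia.
- by move=> i j [].
- move=> [[p0 p1] p2] np; rewrite /delta10 /zexpand /ser02 /=.
  case: ifP => [/eqP e1|_]; last by rewrite scale0r.
  case: ifP => [/eqP e2|_]; last by rewrite scaler0.
  case: p0 e1 np => [j|j] e1 np; last by rewrite zbin_neg // mulr0 scale0r.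
  by case: np; exists j => //; congr (_, _, _); lia.
Qed.

(** Borcherds' identity. The families [A], [B], [C] stand for the two orders of
    composition and for the iterate, so that the same definition serves modules,
    comodules and their opposites. *)
Definition borcherds A B C := forall n m k,
  nsum (fun j : nat => ((-1) ^+ j * zbin K n j) *: A (m + n - j%:Z) (k + j%:Z))
  - nsum (fun j : nat => ((-1) ^ n * ((-1) ^+ j * zbin K n j)) *:
                           B (m + j%:Z) (k + n - j%:Z))
  = nsum (fun j : nat => zbin K m j *: C (n + j%:Z) (k + m - j%:Z)).

Lemma borcherds0 : borcherds (fun _ _ => 0) (fun _ _ => 0) (fun _ _ => 0).
Proof. by move=> n m k; rewrite !nsum0 ?subrr // => j; rewrite scaler0. Qed.

(** Linearity is what reduces the identity to homogeneous vectors. *)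
Lemma borcherdsP (s : K) A A' B B' C C' :
  (forall x y, eventually0 (fun j : nat => A (x - j%:Z) (y + j%:Z))) ->
  (forall x y, eventually0 (fun j : nat => A' (x - j%:Z) (y + j%:Z))) ->
  (forall x y, eventually0 (fun j : nat => B (x + j%:Z) (y - j%:Z))) ->
  (forall x y, eventually0 (fun j : nat => B' (x + j%:Z) (y - j%:Z))) ->
  (forall x y, eventually0 (fun j : nat => C (x + j%:Z) (y - j%:Z))) ->
  (forall x y, eventually0 (fun j : nat => C' (x + j%:Z) (y - j%:Z))) ->
  borcherds A B C -> borcherds A' B' C' ->
  borcherds (fun k l => s *: A k l + A' k l) (fun k l => s *: B k l + B' k l)
            (fun k l => s *: C k l + C' k l).
Proof.
move=> zA zA' zB zB' zC zC' bor bor' n m k.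
have lin (al : nat -> K) (F G : nat -> T) : eventually0 F -> eventually0 G ->
    nsum (fun j => al j *: (s *: F j + G j))
    = s *: nsum (fun j => al j *: F j) + nsum (fun j => al j *: G j).
  move=> zF zG; rewrite -nsumP; try exact: eventually0_scale.
  by apply: eq_nsum => j; rewrite scalerDr !scalerA mulrC.
rewrite !lin // -bor -bor' scalerBr opprD addrACA; congr (_ + _ + _).
Qed.

Let shift n : exists n', n = - n' - 1 :> int.
Proof. by exists (- n - 1); lia. Qed.

Lemma borcherds20P A B C :
  (forall n, fmul (delta12 K) (ser12 A) n - fmul (delta21 K) (ser12 B) n
             = fmul (delta20 K) (ser02 C) n) <-> borcherds A B C.
Proof.
split=> [jac n m k|bor [[n m] k]].
  by rewrite -fmul_delta12 -fmul_delta21 -fmul_delta20.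
have [n' ->] := shift n; have [m' ->] := shift m; have [k' ->] := shift k.
by rewrite fmul_delta12 fmul_delta21 fmul_delta20.
Qed.

Lemma borcherds10P A B C :
  (forall n, fmul (delta12 K) (ser12 A) n - fmul (delta21 K) (ser12 B) n
             = fmul (delta10 K) (ser02 C) n) <-> borcherds A B C.
Proof.
split=> [jac n m k|bor [[n m] k]].
  by rewrite -fmul_delta12 -fmul_delta21 -fmul_delta10.
have [n' ->] := shift n; have [m' ->] := shift m; have [k' ->] := shift k.
by rewrite fmul_delta12 fmul_delta21 fmul_delta10.
Qed.

End JacobiCoefficients.

Section BorcherdsLinear.
Context (K : numFieldType) (S T : lmodType K) (A B C : int -> int -> S).
Hypotheses (zA : forall x y, eventually0 (fun j : nat => A (x - j%:Z) (y + j%:Z)))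
  (zB : forall x y, eventually0 (fun j : nat => B (x + j%:Z) (y - j%:Z)))
  (zC : forall x y, eventually0 (fun j : nat => C (x + j%:Z) (y - j%:Z))).

Let lin (f : S -> T) (al : nat -> K) (F : nat -> S) : linear f -> eventually0 F ->
  nsum (fun j => al j *: f (F j)) = f (nsum (fun j => al j *: F j)).
Proof.
move=> lf zF; rewrite nsum_lin //; last exact: eventually0_scale.
by apply: eq_nsum => j; rewrite (linZ lf).
Qed.

Lemma borcherds_lin (f : S -> T) : linear f -> borcherds A B C ->
  borcherds (fun k l => f (A k l)) (fun k l => f (B k l)) (fun k l => f (C k l)).
Proof. by move=> lf bor n m k; rewrite !lin // -bor linB. Qed.

(** Identities between tensors are checked after applying enough linear maps. *)
Lemma borcherds_separated (X : Type) (f : X -> S -> T) : (forall x, linear (f x)) ->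
  (forall t, (forall x, f x t = 0) -> t = 0) ->
  (forall x, borcherds (fun k l => f x (A k l)) (fun k l => f x (B k l))
    (fun k l => f x (C k l))) -> borcherds A B C.
Proof.
move=> lf sep bor n m k; apply/eqP; rewrite -subr_eq0; apply/eqP/sep => x.
by rewrite !(linB (lf x)) -!lin // bor subrr.
Qed.

End BorcherdsLinear.

(** * Direct sums and finitely supported sums *)

Section FinitelySupportedSums.
Context (I : choiceType).

Lemma fsum_single (T : nmodType) (x : I -> T) i : (forall j, j != i -> x j = 0) ->
  \sum_(j \in [set: I]) x j = x i.
Proof.
by move=> x0; rewrite (fsbigTE [fset i]%fset) ?big_seq_fset1 // => j; rewrite inE => /x0.
Qed.

Lemma fsum_lin (K : pzRingType) (X Y : lmodType K) (f : X -> Y) (x : I -> X) :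
  linear f -> finite_set [set i | x i != 0] ->
  f (\sum_(i \in [set: I]) x i) = \sum_(i \in [set: I]) f (x i).
Proof.
move=> lf fx; have x0 i : i \notin fset_set [set i | x i != 0] -> x i = 0.
  by rewrite in_fset_set // => /negP; rewrite inE /= => /negP /negPn /eqP.
rewrite (fsbigTE _ _ x0) (lin_sum lf) -(fsbigTE _ (fun i => f (x i))) // => i /x0 ->.
exact: lin0.
Qed.

Lemma finite_support_lin (K : pzRingType) (X Y : lmodType K) (F : I -> X -> Y) a u v :
  (forall s, linear (F s)) -> finite_set [set s | F s u != 0] ->
  finite_set [set s | F s v != 0] -> finite_set [set s | F s (a *: u + v) != 0].
Proof.
move=> lF fu fv.
apply: (sub_finite_set (B := [set s | F s u != 0] `|` [set s | F s v != 0])).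
  move=> s /=; have [u0|] := eqVneq (F s u) 0; last by left.
  by rewrite lF u0 scaler0 add0r; right.
by rewrite finite_setU.
Qed.

Lemma finite_support0 (K : pzRingType) (X Y : lmodType K) (F : I -> X -> Y) :
  (forall s, linear (F s)) -> finite_set [set s | F s 0 != 0].
Proof.
by move=> lF; apply: (sub_finite_set _ (finite_set0 I)) => s /=; rewrite (lin0 (lF s)) eqxx.
Qed.

End FinitelySupportedSums.

Section DirectSums.
Context (K : fieldType) (V : lmodType K) (I : choiceType) (W : I -> set V).
Hypothesis dsW : direct_sum W.

Lemma direct_sum_ind (P : V -> Prop) : P 0 ->
  (forall a u v, P u -> P v -> P (a *: u + v)) ->
  (forall i v, W i v -> P v) -> forall v, P v.
Proof.
move=> P0 Plin PW v; have [fx Wx ->] := componentP dsW v.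
rewrite (fsbigTE (fset_set [set i | component W i v != 0])).
  apply: big_ind => // [x y Px Py|i _]; last exact: PW (Wx i).
  by rewrite -[x]scale1r; exact: Plin.
by move=> i; rewrite in_fset_set // => /negP; rewrite inE /= => /negP /negPn /eqP.
Qed.

Lemma fsum_linear (X : lmodType K) (F : I -> V -> X) :
  (forall i, linear (F i)) -> (forall v, finite_set [set i | F i v != 0]) ->
  linear (fun v => \sum_(i \in [set: I]) F i v).
Proof.
move=> lF fF a u v.
pose B := fset_set ([set i | F i u != 0] `|` [set i | F i v != 0]).
have memB i : i \notin B -> F i u = 0 /\ F i v = 0.
  rewrite in_fset_set ?finite_setU // => /negP; rewrite inE /= => /not_orP[nx ny].
  by split; [move: nx|move: ny] => /negP; rewrite negbK => /eqP.
rewrite !(fsbigTE B); first by rewrite scaler_sumr -big_split; apply: eq_bigr => i _; rewrite lF.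
all: move=> i /memB[x0 y0] //.
by rewrite lF x0 y0 scaler0 addr0.
Qed.

Lemma component_eq i j v : W i v -> component W j v = if j == i then v else 0.
Proof. by move=> /(component_homog dsW) /(congr1 (@^~ j)). Qed.

Lemma glue_linear (X : lmodType K) (F : I -> V -> X) : (forall i, linear (F i)) ->
  linear (fun v => \sum_(i \in [set: I]) F i (component W i v)).
Proof.
move=> lF; apply: fsum_linear => [i a u v|v].
  by rewrite component_linear // lF.
have [fx _ _] := componentP dsW v; apply: sub_finite_set fx => i /=.
by apply: contra_neq => ->; exact: lin0.
Qed.

Lemma glue_homog (X : lmodType K) (F : I -> V -> X) i v : (forall i, linear (F i)) ->
  W i v -> \sum_(j \in [set: I]) F j (component W j v) = F i v.
Proof.
move=> lF Wv; rewrite (fsbigTE [fset i]%fset) ?big_seq_fset1 => [|j].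
  by rewrite (component_eq _ Wv) eqxx.
by rewrite inE (component_eq _ Wv) => /negbTE ->; exact: lin0.
Qed.

Lemma linear_eq_homog (X : lmodType K) (f g : V -> X) : linear f -> linear g ->
  (forall i v, W i v -> f v = g v) -> f =1 g.
Proof.
move=> lf lg fg; apply: direct_sum_ind => //; first by rewrite !lin0.
by move=> a u v fu fv; rewrite lf lg fu fv.
Qed.

End DirectSums.

(** * Left and right modules *)

Section Modes.
Context (K : numFieldType) (U : voa_data K) (M : lmodType K).
Implicit Types (c : bool) (Z : int -> U -> M -> M) (a b : U) (w : M).

(** Left modules ([c = true]) and right modules ([c = false]) are treated
    together because the twist below exchanges them. *)
Definition mode2 c Z a x b y w := if c then Z x a (Z y b w) else Z y b (Z x a w).

(** The modes of a left module vanish for large indices, those of a right module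
    for very negative ones. In both cases it is the mode applied first whose
    index runs to the side where it vanishes, so the sums in Borcherds' identity
    are finite. *)
Record vmodes c Z : Prop := VModes {
  vm_bilinear : forall k, bilinear_for *:%R *:%R (Z k);
  vm_truncated : forall a w, exists T : int, forall t, T <= t ->
    Z (if c then t else - t) a w = 0;
  vm_vacuum : forall w k, Z k (voa_vacuum U) w = if k == -1 then w else 0;
  vm_borcherds : forall a b w,
    borcherds (fun k l => mode2 c Z a k b l w) (fun k l => mode2 c Z b l a k w)
              (fun k l => Z l (voa_Y k a b) w)
}.

Lemma mode2_linear1 c Z x b y w : (forall k w, linear (fun a => Z k a w)) ->
  (forall k a, linear (Z k a)) -> linear (fun a => mode2 c Z a x b y w).
Proof. by move=> ll lr s u v; rewrite /mode2; case: c; rewrite ll ?lr. Qed.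

Lemma mode2_linear2 c Z a x y w : (forall k w, linear (fun a => Z k a w)) ->
  (forall k a, linear (Z k a)) -> linear (fun b => mode2 c Z a x b y w).
Proof. by move=> ll lr s u v; rewrite /mode2; case: c; rewrite ll ?lr. Qed.

Lemma eventually0_mode2_of c Z a x b y w : (forall k a, linear (Z k a)) ->
  (forall a w, exists T : int, forall t, T <= t -> Z (if c then t else - t) a w = 0) ->
  eventually0 (fun j : nat => mode2 c Z a (x - j%:Z) b (y + j%:Z) w).
Proof.
move=> lr; rewrite /mode2; case: c => tr.
  have [T HT] := tr b w; exists `|T - y|%N => j Tj.
  by rewrite HT; [rewrite lin0|lia].
have [T HT] := tr a w; exists (absz (T + x)) => j Tj.
by rewrite -[x - _]opprK HT; [rewrite lin0|lia].
Qed.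

Context (c : bool) (Z : int -> U -> M -> M) (hZ : vmodes c Z).

Lemma vm_linl k w : linear (fun a => Z k a w).
Proof. exact: (vm_bilinear hZ k).1. Qed.
Lemma vm_linr k a : linear (Z k a).
Proof. exact: (vm_bilinear hZ k).2. Qed.

Lemma eventually0_mode2 a x b y w :
  eventually0 (fun j : nat => mode2 c Z a (x - j%:Z) b (y + j%:Z) w).
Proof. by apply: eventually0_mode2_of; [exact: vm_linr|exact: vm_truncated hZ]. Qed.

(** Borcherds' identity at n = 0, where only one term of each product survives. *)
Lemma vm_commutator a b w m k :
  mode2 c Z a m b k w - mode2 c Z b k a m w
  = nsum (fun j : nat => zbin K m j *: Z (k + m - j%:Z) (voa_Y j a b) w).
Proof.
have := vm_borcherds hZ a b w 0 m k.
rewrite [X in X - _]nsum_shift0 => [|j]; last by rewrite zbin0l mulr0 scale0r.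
rewrite [X in _ - X]nsum_shift0 => [|j]; last by rewrite zbin0l !mulr0 scale0r.
rewrite zbin0 !addr0 ?subr0 !expr0z ?mul1r ?expr0 !scale1r => ->.
by apply: eq_nsum => j; rewrite add0r.
Qed.

Lemma mode2_vacr a x y w :
  mode2 c Z a x (voa_vacuum U) y w = if y == -1 then Z x a w else 0.
Proof.
rewrite /mode2; case: (c); rewrite (vm_vacuum hZ) //.
by case: ifP => // _; rewrite lin0 //; exact: vm_linr.
Qed.

Lemma mode2_vacl a x y w :
  mode2 c Z (voa_vacuum U) y a x w = if y == -1 then Z x a w else 0.
Proof.
rewrite /mode2; case: (c); rewrite (vm_vacuum hZ) //.
by case: ifP => // _; rewrite lin0 //; exact: vm_linr.
Qed.

(** Borcherds' identity for [a] and the vacuum, at n = -2 and m = 0: in either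
    order of composition only the vacuum mode of index -1 survives, so each of
    the two sums has at most one term. *)
Lemma vm_translation a w k :
  Z k (voa_Y (-2) a (voa_vacuum U)) w = (- k)%:~R *: Z (k - 1) a w.
Proof.
have := vm_borcherds hZ a (voa_vacuum U) w (-2) 0 k.
rewrite [X in _ = X]nsum_shift0 => [|j]; last by rewrite zbin0l scale0r.
rewrite zbin0 scale1r !addr0 => <-.
have d1 (j : nat) : (k + j%:Z == -1) = (j%:Z == -1 - k) by apply/eqP/eqP; lia.
have d2 (j : nat) : (k - 2 - j%:Z == -1) = (j%:Z == k - 1) by apply/eqP/eqP; lia.
have s1 : (-1) ^ (-2 : int) = 1 :> K by rewrite -[LHS]/((-1) ^- 2) sqrrN expr1n invr1.
rewrite (eq_nsum (G := fun j : nat => (j.+1)%:R *: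
    (if j%:Z == -1 - k then Z (-2 - j%:Z) a w else 0))); last first.
  by move=> j; rewrite zbinN2 mode2_vacr d1 add0r.
rewrite [X in _ - X](eq_nsum (G := fun j : nat => (j.+1)%:R *:
    (if j%:Z == k - 1 then Z j%:Z a w else 0))); last first.
  by move=> j; rewrite zbinN2 mode2_vacl d2 add0r s1 mul1r.
rewrite !(nsum_delta (fun j : nat => (j.+1)%:R)).
case: k {d1 d2} => [[|p]|p].
- by rewrite !sub0r oppr0 scale0r.
- rewrite (_ : -1 - p.+1%:Z = Negz p.+1); last lia.
  rewrite (_ : p.+1%:Z - 1 = p%:Z); last lia.
  by rewrite sub0r -scaleNr rmorphN.
- rewrite (_ : -1 - Negz p = p%:Z); last lia.
  rewrite (_ : Negz p - 1 = Negz p.+1); last lia.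
  rewrite subr0 (_ : -2 - p%:Z = Negz p.+1); last lia.
  by congr (_ *: _); rewrite -[LHS]/((p.+1%:Z)%:~R); congr (_%:~R); lia.
Qed.

End Modes.

(** * Vertex operator algebras and their modules *)

Lemma weak_moduleP (K : numFieldType) (U : voa_data K) (M : lmodType K)
    (Z : int -> U -> M -> M) : weak_module Z <-> vmodes true Z.
Proof.
split=> [[bl tr va jac]|[bl tr va bor]]; split=> //.
  by move=> a b w; apply/borcherds10P => n; exact: jac.
by move=> a b w; apply/borcherds10P; exact: bor.
Qed.

Section ModesOfVoa.
Context (K : numFieldType) (U : voa_data K) (hU : is_voa U).
Local Notation y := (@voa_Y K U).
Local Notation one := (@voa_vacuum K U).
Local Notation om := (@voa_omega K U).
Local Notation gr := (@voa_gr K U).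

Lemma voa_modes : vmodes true y.
Proof. exact/weak_moduleP/voa_adjoint. Qed.

Lemma voa_linl k w : linear (fun a => y k a w).
Proof. exact: vm_linl voa_modes k w. Qed.
Lemma voa_linr k a : linear (y k a).
Proof. exact: vm_linr voa_modes k a. Qed.

Lemma voa_L_linear k : linear (@voa_L K U k).
Proof. exact: voa_linr. Qed.

Lemma voa_translationE a : voa_L (-1) a = y (-2) a one.
Proof.
have := voa_derivative hU a one 0.
by rewrite /ser /dz /= !add0r scale1r => <-; rewrite (voa_creation_lim hU).
Qed.

Section OmegaModes.
Context (M : lmodType K) (c : bool) (Z : int -> U -> M -> M) (hZ : vmodes c Z).

Lemma vm_derivative a w k : Z k (voa_L (-1) a) w = (- k)%:~R *: Z (k - 1) a w.
Proof. by rewrite voa_translationE (vm_translation hZ). Qed.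

Lemma vm_commutator_small (m : nat) a b w k :
  mode2 c Z a m%:Z b k w - mode2 c Z b k a m%:Z w
  = \sum_(j < m.+1) zbin K m%:Z j%:Z *: Z (k + m%:Z - j%:Z) (y j%:Z a b) w.
Proof.
rewrite (vm_commutator hZ) (nsumE (n := m.+1)) // => j mj.
by rewrite zbin_small // scale0r.
Qed.

Lemma vm_L0_commutator r b w k : gr r b ->
  mode2 c Z om 1 b k w - mode2 c Z b k om 1 w = (r - k - 1)%:~R *: Z k b w.
Proof.
move=> br; rewrite (vm_commutator_small 1 om b w k) !big_ord_recr big_ord0 /= add0r.
rewrite zbin0 zbin1 !scale1r -[y 0 om b]/(voa_L (-1) b) vm_derivative.
rewrite -[y 1 om b]/(voa_L 0 b) (voa_L0 hU br) (linZ (vm_linl hZ _ _)).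
rewrite !subr0 !addrK -scalerDl -rmorphD /=; congr (_%:~R *: Z _ b w); lia.
Qed.

Lemma vm_L1_commutator r b w k : gr r b ->
  mode2 c Z om 2 b k w - mode2 c Z b k om 2 w
  = (2 * r - k - 2)%:~R *: Z (k + 1) b w + Z k (voa_L 1 b) w.
Proof.
move=> br; rewrite (vm_commutator_small 2 om b w k) !big_ord_recr big_ord0 /= add0r.
rewrite zbin0 zbin1 !scale1r -[y 0 om b]/(voa_L (-1) b) vm_derivative.
rewrite -[y 1 om b]/(voa_L 0 b) (voa_L0 hU br) (linZ (vm_linl hZ _ _)).
rewrite -[y 2 om b]/(voa_L 1 b) zbin_eq zbin1 (_ : _ * _ = 1) ?scale1r; last first.
  by rewrite -[2%:~R]/(2%:R) -[(2 - 1%:Z)%:~R]/(1%:R); field.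
rewrite scalerA -rmorphM !addrK; congr (_ + _).
have e1 : k + 2 - 1 = k + 1 by lia.
rewrite !e1 (_ : k + 2 - 0 - 1 = k + 1); last lia.
rewrite -scalerDl -rmorphD /=; congr (_%:~R *: _); lia.
Qed.

End OmegaModes.

(** L(0) acts on the s-th piece by s, so it separates the pieces: a homogeneous
    component of an eigenvector is zero unless its degree is the eigenvalue. *)
Lemma voa_L0_grade s v : voa_L 0 v = s%:~R *: v -> gr s v.
Proof.
have ds := voa_direct_sum hU.
have L0c i u : component gr i (voa_L 0 u) = i%:~R *: component gr i u.
  move: u; apply: (linear_eq_homog ds).
  - by move=> a u v'; rewrite voa_L_linear component_linear.
  - by move=> a u v'; rewrite component_linear // scalerDr !scalerA mulrC.
  move=> j u uj; rewrite (voa_L0 hU uj) (linZ (component_linear ds _)).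
  by rewrite (component_eq ds _ uj); case: eqP => [->//|_]; rewrite !scaler0.
move=> Lv; have c0 i : i != s -> component gr i v = 0.
  move=> si; have := L0c i v.
  rewrite Lv (linZ (component_linear ds _)) => /eqP.
  rewrite -subr_eq0 -scalerBl scaler_eq0 -rmorphB /= intr_eq0 subr_eq0.
  by rewrite eq_sym (negbTE si) => /eqP.
have [_ Wv ->] := componentP ds v; rewrite (fsbigTE [fset s]%fset) ?big_seq_fset1 //.
by move=> i; rewrite inE => /c0.
Qed.

(** The commutator of L(0) with a mode of [u] is a multiple of that mode. *)
Lemma voa_grade r s t u v : gr r u -> gr s v -> gr (r + s - t - 1) (y t u v).
Proof.
move=> ru sv; apply: voa_L0_grade.
have := vm_L0_commutator voa_modes v t ru; rewrite /mode2 => /(canRL (subrK _)).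
rewrite -/(voa_L 0 _) -[y 1 om v]/(voa_L 0 v) (voa_L0 hU sv) (linZ (voa_linr _ _)).
move=> ->.
by rewrite -scalerDl -rmorphD /=; congr (_%:~R *: _); lia.
Qed.

Lemma voa_L1_grade r a : gr r a -> gr (r - 1) (voa_L 1 a).
Proof.
move=> ra; rewrite (_ : r - 1 = 2 + r - 2 - 1); last lia.
exact: voa_grade (voa_omega_gr hU) ra.
Qed.

Lemma voa_L_vacuum k : -1 <= k -> voa_L k one = 0.
Proof. by move=> k1; apply: (voa_creation_reg hU); lia. Qed.

Lemma voa_omegaE : om = voa_L (-2) one.
Proof. by rewrite -[LHS](voa_creation_lim hU). Qed.

(** The conformal vector is L(-2) applied to the vacuum, and L(k) kills the
    vacuum for k >= -1; only the central term of [L(2), L(-2)] remains. *)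
Lemma voa_L_omega d k : virasoro (@voa_L K U) d -> 0 < k ->
  voa_L k om = if k == 2 then (2%:R^-1 * d) *: one else 0.
Proof.
move=> vir k0; rewrite voa_omegaE; have := vir k (-2) one.
rewrite (voa_L_vacuum (k := k)); last lia.
rewrite (lin0 (voa_L_linear _)) subr0 => ->.
rewrite (voa_L_vacuum (k := k - 2)) ?scaler0 ?add0r; last lia.
rewrite subr_eq0; case: eqP => [->|_]; last by rewrite scale0r.
by congr (_ *: _); rewrite -[_%:~R]/(6%:R); field.
Qed.

(** The commutator formula expresses the Virasoro relations on a module through
    the products of the conformal vector with itself, which are known inside the
    algebra. *)
Lemma vm_virasoro (M : lmodType K) c (Z : int -> U -> M -> M) d p q w :
  vmodes c Z -> virasoro (@voa_L K U) d ->
  mode2 c Z om p om q w - mode2 c Z om q om p w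
  = (p - q)%:~R *: Z (p + q - 1) om w
    + (if p + q == 2 then ((p - 1) ^+ 3 - (p - 1))%:~R / 12%:R * d else 0) *: w.
Proof.
move=> hZ vir; have lz0 k : Z k 0 w = 0 by exact: lin0 (vm_linl hZ _ _).
(* The products of the conformal vector with itself vanish from index 4 on. *)
rewrite (vm_commutator hZ) (nsumE (n := 4)); last first.
  case=> [|[|[|[|i]]]] // _; rewrite (_ : i.+4%:Z = i.+3%:Z + 1); last lia.
  by rewrite -/(voa_L i.+3%:Z om) (voa_L_omega vir) // lz0 scaler0.
rewrite !big_ord_recr big_ord0 /= add0r zbin0 zbin1 scale1r.
rewrite -[y 0 om om]/(voa_L (-1) om) (vm_derivative hZ).
rewrite -[y 1 om om]/(voa_L 0 om) (voa_L0 hU (voa_omega_gr hU)).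
rewrite -[y 2 om om]/(voa_L 1 om) (voa_L_omega vir) //.
rewrite -[y 3 om om]/(voa_L 2 om) (voa_L_omega vir) //=.
rewrite lz0 scaler0 addr0 !(linZ (vm_linl hZ _ _)) (vm_vacuum hZ) scalerA -rmorphM /=.
have e0 : q + p - 0%:Z - 1 = p + q - 1 by lia.
have e1 : q + p - 1%:Z = p + q - 1 by lia.
rewrite e0 e1 -scalerDl -rmorphD /=; congr (_%:~R *: _ + _); first by lia.
have -> : (q + p - 3%:Z == -1) = (p + q == 2) by apply/eqP/eqP; lia.
case: eqP => _; last by rewrite !scaler0 scale0r.
rewrite scalerA; congr (_ *: _).
rewrite !zbin_eq zbin0 !mulr1.
have -> : (p - 2%:Z)%:~R = p%:~R - 2 :> K by rewrite rmorphB.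
have e3 : (p - 1)%:~R = p%:~R - 1 :> K by rewrite rmorphB.
have -> : ((p - 1) ^+ 3 - (p - 1))%:~R = (p%:~R - 1) ^+ 3 - (p%:~R - 1) :> K.
  by rewrite rmorphB rmorphXn /= e3.
rewrite -[(p - 1%:Z)%:~R]/((p - 1)%:~R) e3 (_ : p - 0%:Z = p); last lia.
by field.
Qed.

End ModesOfVoa.

(** * Conjugation of a mode by the exponential of L(1) *)

Section AntidiagonalSums.
Context (T : nmodType).
Implicit Types (F : nat -> nat -> T) (G : nat -> nat -> nat -> T).

Definition sum2 p F := \sum_(j < p.+1) F j (p - j)%N.
Definition sum3 p G := sum2 p (fun i s => sum2 s (G i)).

Lemma eq_sum2 p F F' :
  (forall j q, (j + q)%N = p -> F j q = F' j q) -> sum2 p F = sum2 p F'.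
Proof. by move=> FF; apply: eq_bigr => j _; apply: FF; have := ltn_ord j; lia. Qed.

Lemma eq_sum3 p G G' : (forall i j q, (i + j + q)%N = p -> G i j q = G' i j q) ->
  sum3 p G = sum3 p G'.
Proof.
by move=> GG; apply: eq_sum2 => i s is_; apply: eq_sum2 => j q jq; apply: GG; lia.
Qed.

Lemma sum2_shiftl p F : (forall q, F 0%N q = 0) ->
  sum2 p.+1 F = sum2 p (fun j q => F j.+1 q).
Proof. by move=> F0; rewrite /sum2 big_ord_recl F0 add0r. Qed.

Lemma sum2_shiftr p F : (forall j, F j 0%N = 0) ->
  sum2 p.+1 F = sum2 p (fun j q => F j q.+1).
Proof.
move=> F0; rewrite /sum2 big_ord_recr /= subnn F0 addr0.
by apply: eq_bigr => j _; rewrite subSn //; have := ltn_ord j; lia.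
Qed.

Lemma sum3_shift1 p G : (forall j q, G 0%N j q = 0) ->
  sum3 p.+1 G = sum3 p (fun i j q => G i.+1 j q).
Proof. by move=> G0; apply: sum2_shiftl => q; rewrite /sum2 big1. Qed.

Lemma sum3_shift2 p G : (forall i q, G i 0%N q = 0) ->
  sum3 p.+1 G = sum3 p (fun i j q => G i j.+1 q).
Proof.
move=> G0; rewrite /sum3 sum2_shiftr => [|i]; last by rewrite /sum2 big_ord1.
by apply: eq_sum2 => i s _; rewrite sum2_shiftl.
Qed.

Lemma sum3_shift3 p G : (forall i j, G i j 0%N = 0) ->
  sum3 p.+1 G = sum3 p (fun i j q => G i j q.+1).
Proof.
move=> G0; rewrite /sum3 sum2_shiftr => [|i]; last by rewrite /sum2 big_ord1.
by apply: eq_sum2 => i s _; rewrite sum2_shiftr.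
Qed.

Lemma sum3D p G G' :
  sum3 p (fun i j q => G i j q + G' i j q) = sum3 p G + sum3 p G'.
Proof. by rewrite -big_split; apply: eq_bigr => i _; rewrite -big_split. Qed.

Lemma sum_trunc n m (F : nat -> T) : (n <= m)%N ->
  (forall i, (n <= i)%N -> F i = 0) -> \sum_(i < m) F i = \sum_(i < n) F i.
Proof.
move=> nm F0; rewrite -!(big_mkord xpredT F) (big_cat_nat_idem _ _ nm) //=.
  by rewrite [X in _ + X]big_nat_cond [X in _ + X]big1 ?addr0 // => i /andP[/andP[/F0]].
by rewrite addr0.
Qed.

Lemma sum2_box J L F : (forall j q, (J <= j)%N || (L <= q)%N -> F j q = 0) ->
  \sum_(p < J + L) sum2 p F = \sum_(j < J) \sum_(q < L) F j q.
Proof.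
move=> F0; have tri P : \sum_(p < P) sum2 p F = \sum_(j < P) \sum_(q < P - j) F j q.
  elim: P => [|P IH]; first by rewrite !big_ord0.
  rewrite big_ord_recr /= IH [RHS]big_ord_recr /= subSnn big_ord1.
  rewrite /sum2 big_ord_recr /= subnn addrA -big_split; congr (_ + _).
  by apply: eq_bigr => j _; rewrite subSn ?big_ord_recr //; exact: ltnW.
rewrite tri (@sum_trunc J _ (fun j => \sum_(q < J + L - j) F j q)) ?leq_addr //.
  apply: eq_bigr => j _; apply: sum_trunc => [|q Lq]; last by rewrite F0 // Lq orbT.
  by have := ltn_ord j; lia.
by move=> j Jj; rewrite big1 // => q _; rewrite F0 // Jj.
Qed.

(** A sum over all of N^3 can be grouped by total degree when its support lies
    in a cube. *)
Lemma sum3_box J G :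
  (forall i j q, [|| (J <= i)%N, (J <= j)%N | (J <= q)%N] -> G i j q = 0) ->
  \sum_(p < J + (J + J)) sum3 p G = \sum_(i < J) \sum_(j < J) \sum_(q < J) G i j q.
Proof.
move=> G0; rewrite sum2_box => [|i s].
  by apply: eq_bigr => i _; rewrite sum2_box // => j q jq; rewrite G0 // jq orbT.
case: (leqP J i) => [Ji _|_ /= Js].
  by rewrite /sum2 big1 // => q _; rewrite G0 // Ji.
rewrite /sum2 big1 // => j _; rewrite G0 //.
case: (leqP J j) => [_|jJ]; rewrite ?orbT //=; apply/orP; right; lia.
Qed.

End AntidiagonalSums.

Lemma sum3_lin (K : pzRingType) (V W : lmodType K) (f : V -> W) p G : linear f ->
  f (sum3 p G) = sum3 p (fun i j q => f (G i j q)).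
Proof.
move=> lf; rewrite /sum3 /sum2 lin_sum //; apply: eq_bigr => i _.
by rewrite lin_sum.
Qed.

Section DividedPowers.
Context (K : numFieldType) (U : voa_data K) (hU : is_voa U).
Local Notation y := (@voa_Y K U).
Local Notation one := (@voa_vacuum K U).
Local Notation om := (@voa_omega K U).
Local Notation gr := (@voa_gr K U).

Definition divpow (j : nat) (a : U) : U := (j`!)%:R^-1 *: iter j (@voa_L K U 1) a.

Lemma divpow0 a : divpow 0 a = a.
Proof. by rewrite /divpow fact0 invr1 scale1r. Qed.

Lemma divpowS j a : (j.+1)%:R *: divpow j.+1 a = voa_L 1 (divpow j a).
Proof.
rewrite /divpow (linZ (voa_L_linear hU 1)) scalerA; congr (_ *: _).
have j0 : (j.+1)%:R != 0 :> K by rewrite pnatr_eq0.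
have f0 : (j`!)%:R != 0 :> K by rewrite pnatr_eq0 -lt0n fact_gt0.
by rewrite factS natrM invfM mulrA divff // mul1r.
Qed.

Lemma divpow_linear j : linear (divpow j).
Proof.
have Li : linear (iter j (@voa_L K U 1)).
  by elim: j => [|j IH] s u v //=; rewrite IH (voa_L_linear hU).
by move=> s u v; rewrite /divpow Li scalerDr !scalerA mulrC.
Qed.

Lemma divpow_grade r j a : gr r a -> gr (r - j%:Z) (divpow j a).
Proof.
move=> ra; apply: subspaceZ; first exact: (voa_direct_sum hU).1.
elim: j => [|j IH]; first by rewrite subr0.
rewrite (_ : r - j.+1%:Z = r - j%:Z - 1); last lia.
exact: voa_L1_grade.
Qed.

Lemma divpow_divpow i j a : divpow i (divpow j a) = 'C(i + j, j)%:R *: divpow (i + j) a.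
Proof.
have f0 k : (k`!)%:R != 0 :> K by rewrite pnatr_eq0 -lt0n fact_gt0.
have Li : linear (iter i (@voa_L K U 1)).
  by elim: i => [|i IH] s u v //=; rewrite IH (voa_L_linear hU).
rewrite /divpow (linZ Li) -iterD !scalerA; congr (_ *: _).
have e := bin_fact (leq_addl i j); rewrite addnK in e.
rewrite -e !natrM; have := f0 (i + j)%N; rewrite -e !natrM !mulf_eq0 !negb_or.
move=> /andP[b0 /andP[j0 i0]]; field.
by rewrite b0 j0 i0.
Qed.

Lemma divpow_eventually0 a : exists J, forall j, (J <= j)%N -> divpow j a = 0.
Proof.
have [N HN] := voa_bounded hU.
move: a; apply: (direct_sum_ind (voa_direct_sum hU)).
- by exists 0%N => j _; rewrite (lin0 (divpow_linear j)).
- move=> s u v [J HJ] [L HL]; exists (maxn J L) => j.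
  by rewrite geq_max divpow_linear => /andP[/HJ -> /HL ->]; rewrite scaler0 addr0.
- move=> r a ra; exists (absz (r - N)).+1 => j Jj.
  by have := divpow_grade j ra; rewrite HN //; lia.
Qed.

Lemma divpow_vacuum j : divpow j.+1 one = 0.
Proof.
have L1 : iter j.+1 (@voa_L K U 1) one = 0.
  elim: j => [|j IH] /=; first by rewrite (voa_L_vacuum hU).
  by rewrite -iterS IH (lin0 (voa_L_linear hU 1)).
by rewrite /divpow L1 scaler0.
Qed.

(** The coefficientwise form of
    e^(xL(1)) Y(a,z) b = Y(e^(x(1-xz)L(1)) (1-xz)^(-2L(0)) a, z/(1-xz)) e^(xL(1)) b;
    by induction on p it integrates the commutator of L(1) with a mode. *)
Lemma divpow_mode r a b n p : gr r a ->
  divpow p (y n a b) = sum3 p (fun i j q =>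
    zbin K (2 * r - n - 2 - j%:Z) i%:Z *: y (n + i%:Z) (divpow j a) (divpow q b)).
Proof.
move=> ra; elim: p => [|p IH].
  by rewrite /sum3 /sum2 !big_ord1 /= !divpow0 zbin0 scale1r addr0.
have p0 : (p.+1)%:R != 0 :> K by rewrite pnatr_eq0.
apply: (scalerI p0); rewrite divpowS IH (sum3_lin _ _ (voa_L_linear hU 1)).
pose A : int := 2 * r - n - 2.
pose G (i j q : nat) := y (n + i%:Z) (divpow j a) (divpow q b).
have L1G i j q : voa_L 1 (G i j q) = (A - 2 * j%:Z - i%:Z)%:~R *: G i.+1 j q
    + (j.+1)%:R *: G i j.+1 q + (q.+1)%:R *: G i j q.+1.
  have := vm_L1_commutator hU (voa_modes hU) (divpow q b) (n + i%:Z) (divpow_grade j ra).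
  rewrite /mode2 -!/(voa_L 1 _) => /(canRL (subrK _)) ->.
  rewrite -divpowS -divpowS (linZ (voa_linl hU _ _)) (linZ (voa_linr hU _ _)) /G.
  congr (_ *: y _ _ _ + _ + _); last lia.
  by congr (_%:~R); rewrite /A; lia.
rewrite [LHS](eq_sum3 (G' := fun i j q =>
   (zbin K (A - j%:Z) i%:Z * (A - 2 * j%:Z - i%:Z)%:~R) *: G i.+1 j q +
   ((zbin K (A - j%:Z) i%:Z * (j.+1)%:R) *: G i j.+1 q +
    (zbin K (A - j%:Z) i%:Z * (q.+1)%:R) *: G i j q.+1))); last first.
  by move=> i j q _; rewrite (linZ (voa_L_linear hU 1)) L1G !scalerDr !scalerA addrA.
rewrite !sum3D.
rewrite (_ : sum3 p _ = sum3 p.+1 (fun i j q => (zbin K (A - j%:Z) (i%:Z - 1) *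
    (A - 2 * j%:Z - i%:Z + 1)%:~R) *: G i j q)); last first.
  rewrite sum3_shift1 => [|j q]; last by rewrite zbin_neg // mul0r scale0r.
  apply: eq_sum3 => i j q _; rewrite (_ : i.+1%:Z - 1 = i%:Z); last lia.
  by congr ((_ * _%:~R) *: _); lia.
rewrite (_ : sum3 p (fun i j q => _ *: G i j.+1 q) = sum3 p.+1 (fun i j q =>
    (zbin K (A - j%:Z + 1) i%:Z * j%:R) *: G i j q)); last first.
  rewrite sum3_shift2 => [|i q]; last by rewrite mulr0 scale0r.
  by apply: eq_sum3 => i j q _; congr ((zbin _ _ _ * _) *: _); lia.
rewrite (_ : sum3 p (fun i j q => _ *: G i j q.+1) = sum3 p.+1 (fun i j q =>
    (zbin K (A - j%:Z) i%:Z * q%:R) *: G i j q)); last first.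
  by rewrite sum3_shift3 => // i j; rewrite mulr0 scale0r.
rewrite -!sum3D (sum3_lin p.+1 _ (f := fun v => (p.+1)%:R *: v)); last first.
  by move=> s u v; rewrite scalerDr !scalerA mulrC.
apply: eq_sum3 => i j q ijq; rewrite -!scalerDl scalerA -/(G i j q) -/A; congr (_ *: _).
rewrite -ijq !natrD; case: i {ijq} => [|i].
  by rewrite zbin_neg // !zbin0 mul0r !add0r !mul1r mulr1.
rewrite (_ : i.+1%:Z - 1 = i%:Z); last lia.
rewrite zbin_pascal; have := zbinS K (A - j%:Z) i.
rewrite (_ : A - 2 * j%:Z - i.+1%:Z + 1 = A - j%:Z - i%:Z - j%:Z); last lia.
rewrite (rmorphB _ _ j%:Z) /= -[(j%:Z)%:~R]/(j%:R).
move: (zbin K _ i.+1) (zbin K _ i) (_%:~R) => u v x uv.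
transitivity (x * v + (u * j%:R + u * q%:R)); first by ring.
by rewrite -uv; ring.
Qed.

End DividedPowers.

(** * The twist *)

Section Twist.
Context (K : numFieldType) (U : voa_data K) (hU : is_voa U) (M : lmodType K).
Context (c : bool) (Z : int -> U -> M -> M) (hZ : vmodes c Z).
Local Notation y := (@voa_Y K U).
Local Notation one := (@voa_vacuum K U).
Local Notation gr := (@voa_gr K U).

(** In terms of degrees, with X(a)_d the mode of [a] that shifts degrees by d
    before the twist and R(a)_d the one after it, the formula reads
    R(a)_d = X(e^(L(1)) (-1)^(L(0)) a)_d. *)
Definition twist_homog (Z : int -> U -> M -> M) r k a w : M :=
  (-1) ^ r *: nsum (fun j => Z (2 * r - k - 2 - j%:Z) (divpow j a) w).

Definition twist (Z : int -> U -> M -> M) k a w : M :=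
  \sum_(r \in [set: int]) twist_homog Z r k (component gr r a) w.

Let ds := voa_direct_sum hU.

Lemma eventually0_divpow (F : nat -> U -> M) a : (forall j, linear (F j)) ->
  eventually0 (fun j => F j (divpow j a)).
Proof.
by move=> lF; have [J HJ] := divpow_eventually0 hU a; exists J => j /HJ ->; exact: lin0.
Qed.

Lemma twist_homog_linl r k w : linear (fun a => twist_homog Z r k a w).
Proof.
move=> s u v; rewrite /twist_homog scalerA [s * _]mulrC -scalerA -scalerDr; congr (_ *: _).
rewrite -nsumP; last 2 first.
- exact: eventually0_divpow (fun j => vm_linl hZ _ w).
- exact: eventually0_divpow (fun j => vm_linl hZ _ w).
by apply: eq_nsum => j; rewrite (divpow_linear hU) (vm_linl hZ).
Qed.

Lemma twist_homog_linr r k a : linear (twist_homog Z r k a).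
Proof.
move=> s u v; rewrite /twist_homog scalerA [s * _]mulrC -scalerA -scalerDr; congr (_ *: _).
rewrite -nsumP; last 2 first.
- exact: eventually0_divpow (fun j => vm_linl hZ _ u).
- exact: eventually0_divpow (fun j => vm_linl hZ _ v).
by apply: eq_nsum => j; rewrite (vm_linr hZ).
Qed.

Lemma twistE r k a w : gr r a -> twist Z k a w = twist_homog Z r k a w.
Proof.
exact: (glue_homog ds (F := fun r a => twist_homog Z r k a w)
  (fun r => twist_homog_linl r k w)).
Qed.

Lemma twist_linl k w : linear (fun a => twist Z k a w).
Proof.
exact: (glue_linear ds (F := fun r a => twist_homog Z r k a w)
  (fun r => twist_homog_linl r k w)).
Qed.

Lemma twist_linr k a : linear (twist Z k a).
Proof.
move: a => a s u v; move: a.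
apply: (linear_eq_homog ds); first exact: twist_linl.
  move=> t a b; rewrite !twist_linl !scalerDr !scalerA [s * t]mulrC !addrA.
  by congr (_ + _); rewrite addrAC.
by move=> r a ra; rewrite !(twistE _ _ ra) twist_homog_linr.
Qed.

Lemma twist_sum r k a w J : gr r a -> (forall j, (J <= j)%N -> divpow j a = 0) ->
  twist Z k a w = (-1) ^ r *: \sum_(j < J) Z (2 * r - k - 2 - j%:Z) (divpow j a) w.
Proof.
move=> ra aJ; rewrite (twistE _ _ ra) /twist_homog (nsumE (n := J)) // => j /aJ ->.
exact: lin0 (vm_linl hZ _ _).
Qed.

Lemma twist_vacuum w k : twist Z k one w = if k == -1 then w else 0.
Proof.
rewrite (twist_sum (J := 1) _ _ (voa_vacuum_gr hU)); last first.
  by case=> // j _; exact: divpow_vacuum.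
rewrite big_ord1 divpow0 expr0z scale1r (vm_vacuum hZ).
by congr (if _ then _ else _); apply/eqP/eqP => /=; lia.
Qed.

Lemma twist_truncated a w : exists T : int, forall t, T <= t ->
  twist Z (if ~~ c then t else - t) a w = 0.
Proof.
move: a; apply: (direct_sum_ind ds).
- by exists 0 => t _; exact: lin0 (twist_linl _ _).
- move=> s u v [T HT] [T' HT']; exists (Num.max T T') => t.
  by rewrite ge_max twist_linl => /andP[/HT -> /HT' ->]; rewrite scaler0 addr0.
move=> r a ra; have [J HJ] := divpow_eventually0 hU a.
have [T HT] : exists T : int, forall j t, (j < J)%N -> T <= t ->
    Z (if c then t else - t) (divpow j a) w = 0.
  elim: (J) => [|L [T HT]]; first by exists 0.
  have [T' HT'] := vm_truncated hZ (divpow L a) w.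
  exists (Num.max T T') => j t; rewrite ge_max ltnS leq_eqVlt.
  move=> /orP[/eqP -> /andP[_ /HT'] //|jL /andP[Tt _]]; exact: HT.
exists (Num.max (T + 2 * r + J%:Z) (T - 2 * r + J%:Z + 2)) => t; rewrite ge_max => /andP[t1 t2].
rewrite (twist_sum _ _ ra HJ) big1 ?scaler0 // => j _.
have := HT j; case: (c) => /= H; have jJ := ltn_ord j.
  by apply: H => //; lia.
rewrite -[2 * r - t - 2 - j%:Z]opprK; apply: H => //; lia.
Qed.

(** The operators are composed in the same order on both sides; as [c] changes,
    [a] and [b] trade places. *)
Lemma mode2_twist r s a b w J x x' : gr r a -> gr s b ->
  (forall j, (J <= j)%N -> divpow j a = 0) -> (forall j, (J <= j)%N -> divpow j b = 0) ->
  mode2 (~~ c) (twist Z) a x b x' w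
  = (-1) ^ (r + s) *: \sum_(j < J) \sum_(q < J)
      mode2 c Z (divpow q b) (2 * s - x' - 2 - q%:Z) (divpow j a) (2 * r - x - 2 - j%:Z) w.
Proof.
move=> ra sb aJ bJ; rewrite expfzDr; last by rewrite oppr_eq0 oner_eq0.
rewrite /mode2; move: hZ => hZ0; case: c hZ0 => /= hZ0.
  rewrite (twist_sum x' _ sb bJ) (twist_sum x w ra aJ) [_ ^ _ * _]mulrC -scalerA.
  congr (_ *: _); rewrite exchange_big [RHS]scaler_sumr; apply: eq_bigr => q _.
  by rewrite (linZ (vm_linr hZ0 _ _)) (lin_sum (vm_linr hZ0 _ _)).
rewrite (twist_sum x _ ra aJ) (twist_sum x' w sb bJ) -scalerA.
congr (_ *: _); rewrite [RHS]scaler_sumr; apply: eq_bigr => j _.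
by rewrite (linZ (vm_linr hZ0 _ _)) (lin_sum (vm_linr hZ0 _ _)).
Qed.

Section Homogeneous.
Variables (r s : int) (a b : U) (w : M) (J : nat).
Hypotheses (ra : gr r a) (sb : gr s b).
Hypotheses (aJ : forall j, (J <= j)%N -> divpow j a = 0)
  (bJ : forall j, (J <= j)%N -> divpow j b = 0).
Variable n : int.
Hypothesis abJ : forall t j q : nat, (J <= t)%N -> y (n + t%:Z) (divpow j a) (divpow q b) = 0.

(** The identity
    Res_z (1+z)^m z^n e^(L(1)) (-1)^(L(0)) Y(a,z) b
      = \pm Res_w (1+w)^(m_j) w^n Y(a_j,w) b_q, summed over j and q,
    where w = - z / (1 + z) and a_j, b_q are divided powers of L(1) applied to
    [a] and [b]: [divpow_mode] expands e^(L(1)) on the products of [a] and [b],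
    and [zbin_conv] carries out the substitution. *)
Lemma twist_product m k :
  nsum (fun i : nat => zbin K m i%:Z *: twist Z (k + m - i%:Z) (y (n + i%:Z) a b) w)
  = (-1) ^ (r + s - n - 1) *: \sum_(j < J) \sum_(q < J) nsum (fun t : nat =>
      zbin K (2 * r - n - 2 - j%:Z - m) t%:Z *:
      Z (2 * s - n - 2 - k - q%:Z + (2 * r - n - 2 - j%:Z - m) - t%:Z)
        (y (n + t%:Z) (divpow j a) (divpow q b)) w).
Proof.
pose X (j q t : nat) :=
  Z (2 * s - n - 2 - k - q%:Z + (2 * r - n - 2 - j%:Z - m) - t%:Z)
        (y (n + t%:Z) (divpow j a) (divpow q b)) w.
have X0 j q t : [|| (J <= t)%N, (J <= j)%N | (J <= q)%N] -> X j q t = 0.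
  rewrite /X => /or3P[/abJ ->|/aJ ->|/bJ ->];
    rewrite ?(lin0 (voa_linl hU _ _)) ?(lin0 (voa_linr hU _ _)) //;
    exact: lin0 (vm_linl hZ _ _).
pose Y (j i : nat) := 2 * r - n - 2 - j%:Z - i%:Z.
have inner i : twist Z (k + m - i%:Z) (y (n + i%:Z) a b) w
    = (-1) ^ (r + s - n - 1) *: ((-1) ^+ i *: \sum_(l < J) \sum_(j < J) \sum_(q < J)
        zbin K (Y j i) l%:Z *: X j q (i + l)%N).
  have gi : gr (r + s - n - 1 - i%:Z) (y (n + i%:Z) a b).
    rewrite (_ : _ - i%:Z = r + s - (n + i%:Z) - 1); last lia.
    exact: voa_grade.
  have di p : divpow p (y (n + i%:Z) a b) = sum3 p (fun l j q =>
      zbin K (Y j i) l%:Z *: y (n + (i + l)%N%:Z) (divpow j a) (divpow q b)).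
    rewrite (divpow_mode hU _ _ _ ra); apply: eq_sum3 => l j q _.
    by congr (zbin _ _ _ *: y _ _ _); rewrite /Y; lia.
  have z0 l j q : [|| (J <= l)%N, (J <= j)%N | (J <= q)%N] ->
      zbin K (Y j i) l%:Z *: X j q (i + l)%N = 0.
    move=> ljq; rewrite X0 ?scaler0 //; move/or3P: ljq => [h|->|->]; rewrite ?orbT //.
    by rewrite (leq_trans h) // leq_addl.
  have zp p : Z (2 * (r + s - n - 1 - i%:Z) - (k + m - i%:Z) - 2 - p%:Z)
      (divpow p (y (n + i%:Z) a b)) w
      = sum3 p (fun l j q => zbin K (Y j i) l%:Z *: X j q (i + l)%N).
    rewrite di (sum3_lin _ _ (vm_linl hZ _ w)); apply: eq_sum3 => l j q ljq.
    rewrite (linZ (vm_linl hZ _ _)); congr (_ *: Z _ _ _); lia.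
  rewrite (twistE _ _ gi) /twist_homog signB -scalerA; congr (_ *: (_ *: _)).
  rewrite (eq_nsum zp) -(sum3_box z0); apply: nsumE => p Jp.
  rewrite /sum3 /sum2 big1 // => -[l lp] _; rewrite big1 // => -[j jp] _ /=.
  apply: z0; move: lp jp => /=; lia.
rewrite (eq_nsum (G := fun i => (-1) ^ (r + s - n - 1) *: (zbin K m i%:Z *:
  ((-1) ^+ i *: \sum_(l < J) \sum_(j < J) \sum_(q < J)
        zbin K (Y j i) l%:Z *: X j q (i + l)%N)))); last first.
  by move=> i; rewrite inner !scalerA [zbin K m _ * _]mulrC.
have s0 i l j q : (J <= i)%N -> zbin K (Y j i) l%:Z *: X j q (i + l)%N = 0.
  by move=> Ji; rewrite X0 ?scaler0 // (leq_trans Ji) // leq_addr.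
have tz i : (J <= i)%N -> \sum_(l < J) \sum_(j < J) \sum_(q < J)
        zbin K (Y j i) l%:Z *: X j q (i + l)%N = 0.
  by move=> Ji; do 3!(rewrite big1 // => ? _); exact: s0.
rewrite nsumZ; last by exists J => i /tz ->; rewrite !scaler0.
congr (_ *: _); rewrite (nsumE (n := J)) => [|i /tz ->]; last by rewrite !scaler0.
rewrite (eq_bigr (fun i : 'I_J => \sum_(j < J) \sum_(q < J) \sum_(l < J)
   ((-1) ^+ i * zbin K m i%:Z * zbin K (Y j i) l%:Z) *: X j q (i + l)%N)); last first.
  move=> i _; rewrite scalerA exchange_big scaler_sumr; apply: eq_bigr => j _.
  rewrite exchange_big scaler_sumr; apply: eq_bigr => q _; rewrite scaler_sumr.
  by apply: eq_bigr => l _; rewrite scalerA [_ * (-1) ^+ i]mulrC.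
rewrite exchange_big; apply: eq_bigr => j _; rewrite exchange_big; apply: eq_bigr => q _.
rewrite -(sum2_box (F := fun i l => ((-1) ^+ i * zbin K m i%:Z * zbin K (Y j i) l%:Z) *:
  X j q (i + l)%N)); last first.
  move=> i l il; rewrite X0 ?scaler0 //; apply/orP; left; lia.
rewrite (nsumE (n := (J + J)%N)) => [|t Jt]; last first.
  by rewrite -/(X j q t) X0 ?scaler0 //; apply/orP; left; lia.
apply: eq_bigr => t _; rewrite -/(X j q t) -zbin_conv scaler_suml.
apply: eq_bigr => i _; rewrite subnKC //; have := ltn_ord i; lia.
Qed.

(** After [twist_product] the right-hand side is a sum of right-hand sides of
    Borcherds' identity for [Z]. Expanding the left-hand side with [mode2_twist]
    gives the corresponding left-hand sides, with the two products exchanged;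
    the sign (-1)^(n+1) of the exchange is that of [twist_product]. *)
Lemma twist_borcherds_homog m k :
  nsum (fun j : nat => ((-1) ^+ j * zbin K n j) *:
     mode2 (~~ c) (twist Z) a (m + n - j%:Z) b (k + j%:Z) w)
  - nsum (fun j : nat => ((-1) ^ n * ((-1) ^+ j * zbin K n j)) *:
     mode2 (~~ c) (twist Z) b (k + n - j%:Z) a (m + j%:Z) w)
  = nsum (fun j : nat => zbin K m j *: twist Z (k + m - j%:Z) (y (n + j%:Z) a b) w).
Proof.
rewrite twist_product; have box (al : nat -> K) (be : K) (F : nat -> nat -> nat -> M) :
    (forall j q, eventually0 (F j q)) ->
    nsum (fun i => al i *: (be *: \sum_(j < J) \sum_(q < J) F j q i))
    = be *: \sum_(j < J) \sum_(q < J) nsum (fun i => al i *: F j q i).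
  move=> Fz; have Fz' j q := eventually0_scale al (Fz j q).
  rewrite (eq_nsum (G := fun i => be *: (\sum_(j < J) \sum_(q < J) al i *: F j q i))).
    rewrite nsumZ; last exact: eventually0_sum (fun j => eventually0_sum J (Fz' j)).
    congr (_ *: _); rewrite (nsum_sum J (fun j => eventually0_sum J (Fz' j))).
    apply: eq_bigr => j _; by rewrite -(nsum_sum J (Fz' j)).
  move=> i; rewrite scalerA mulrC -scalerA scaler_sumr; congr (_ *: _).
  by apply: eq_bigr => j _; rewrite scaler_sumr.
pose mj (j : nat) := 2 * r - n - 2 - j%:Z - m.
pose kq (q : nat) := 2 * s - n - 2 - k - q%:Z.
pose P (j q i : nat) := mode2 c Z (divpow j a) (mj j + n - i%:Z) (divpow q b) (kq q + i%:Z) w.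
pose Q (j q i : nat) := mode2 c Z (divpow q b) (kq q + n - i%:Z) (divpow j a) (mj j + i%:Z) w.
have Pz j q : eventually0 (P j q) by exact: eventually0_mode2.
have Qz j q : eventually0 (Q j q) by exact: eventually0_mode2.
pose al (i : nat) := (-1) ^+ i * zbin K n i%:Z.
have nn : (-1) ^ n * (-1) ^ n = 1 :> K.
  by rewrite -expfzMl mulrNN mulr1 exp1rz.
rewrite [X in X - _](eq_nsum (G := fun i => al i *: ((-1) ^ (r + s) *:
    \sum_(j < J) \sum_(q < J) Q j q i))); last first.
  move=> i; rewrite (mode2_twist _ _ _ ra sb aJ bJ); congr (_ *: (_ *: _)).
  apply: eq_bigr => j _; apply: eq_bigr => q _.
  by rewrite /Q /kq /mj; congr mode2; lia.
rewrite [X in _ - X](eq_nsum (G := fun i => ((-1) ^ n * al i) *: ((-1) ^ (r + s) *: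
    \sum_(j < J) \sum_(q < J) P j q i))); last first.
  move=> i; rewrite (mode2_twist _ _ _ sb ra bJ aJ) [s + r]addrC; congr (_ *: (_ *: _)).
  rewrite exchange_big; apply: eq_bigr => j _; apply: eq_bigr => q _.
  by rewrite /P /kq /mj; congr mode2; lia.
rewrite !box // -scalerBr -sumrB.
rewrite (_ : r + s - n - 1 = r + s - n - 1%N%:Z) // signB expr1 mulrN1.
have s0 : (-1 : K) != 0 by rewrite oppr_eq0 oner_eq0.
have nV : ((-1) ^ n)^-1 = (-1) ^ n :> K by
  have e0 : (-1) ^ n != 0 :> K; [rewrite expfz_neq0|apply: (mulfI e0); rewrite nn divff].
have -> : (-1) ^ (r + s - n) = (-1) ^ (r + s) * (-1) ^ n :> K.
  by rewrite expfzDr // -invr_expz nV.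
rewrite scaleNr -scalerN -scalerA; congr (_ *: _).
rewrite -sumrN scaler_sumr; apply: eq_bigr => j _.
rewrite -sumrB -sumrN scaler_sumr; apply: eq_bigr => q _.
have := vm_borcherds hZ (divpow j a) (divpow q b) w n (mj j) (kq q).
rewrite -/(nsum _) => <-.
rewrite opprB scalerBr; congr (_ - _).
  rewrite -nsumZ; last exact: eventually0_scale (Qz j q).
  by apply: eq_nsum => i; rewrite scalerA mulrA nn mul1r.
rewrite -nsumZ; last exact: eventually0_scale (Pz j q).
by apply: eq_nsum => i; rewrite scalerA.
Qed.

End Homogeneous.
End Twist.

Section TwistModes.
Context (K : numFieldType) (U : voa_data K) (hU : is_voa U) (M : lmodType K).
Context (c : bool) (Z : int -> U -> M -> M) (hZ : vmodes c Z).
Local Notation y := (@voa_Y K U).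
Local Notation gr := (@voa_gr K U).

Let ds := voa_direct_sum hU.
Let ll := twist_linl hU hZ.
Let lr := twist_linr hU hZ.
Let tr := twist_truncated hU hZ.

Lemma twist_borcherds a b w :
  borcherds (fun k l => mode2 (~~ c) (twist Z) a k b l w)
            (fun k l => mode2 (~~ c) (twist Z) b l a k w)
            (fun k l => twist Z l (y k a b) w).
Proof.
have zA a' b' x x' : eventually0 (fun j : nat =>
    mode2 (~~ c) (twist Z) a' (x - j%:Z) b' (x' + j%:Z) w).
  exact: eventually0_mode2_of lr tr.
have zC a' b' x x' : eventually0 (fun j : nat => twist Z (x' - j%:Z) (y (x + j%:Z) a' b') w).
  have [T HT] := vm_truncated (voa_modes hU) a' b'.
  exists (absz (T - x)) => j Tj; rewrite HT; last lia.
  exact: lin0 (ll _ _).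
have z0 k : (forall d, twist Z k 0 d = 0) by move=> d; exact: lin0 (ll _ _).
have bor0 : borcherds (fun _ _ => 0 : M) (fun _ _ => 0) (fun _ _ => 0) := @borcherds0 _ _.
have ext (A B C A' B' C' : int -> int -> M) :
    (forall k l, A k l = A' k l) -> (forall k l, B k l = B' k l) ->
    (forall k l, C k l = C' k l) -> borcherds A' B' C' -> borcherds A B C.
  move=> eA eB eC.
  have -> : A = A' by apply/funext => k; apply/funext => l; exact: eA.
  have -> : B = B' by apply/funext => k; apply/funext => l; exact: eB.
  by have -> : C = C' by apply/funext => k; apply/funext => l; exact: eC.
move: a; apply: (direct_sum_ind ds).
- apply: ext bor0 => k l; rewrite ?(lin0 (voa_linl hU _ _)) ?z0 //.
    by rewrite /mode2; case: (~~ c); rewrite z0 ?(lin0 (lr _ _)).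
  by rewrite /mode2; case: (~~ c); rewrite z0 ?(lin0 (lr _ _)).
- move=> s u v bu bv.
  apply: ext (borcherdsP s _ _ _ _ _ _ bu bv); try by move=> x x'; exact: zA.
  + by move=> k l; rewrite (mode2_linear1 _ _ _ _ _ ll lr).
  + by move=> k l; rewrite (mode2_linear2 _ _ _ _ _ ll lr).
  + by move=> k l; rewrite (voa_linl hU) ll.
  + by move=> x x'; exact: zC.
  + by move=> x x'; exact: zC.
move=> r a ra; move: b; apply: (direct_sum_ind ds).
- apply: ext bor0 => k l; rewrite ?(lin0 (voa_linr hU _ _)) ?z0 //.
    by rewrite /mode2; case: (~~ c); rewrite z0 ?(lin0 (lr _ _)).
  by rewrite /mode2; case: (~~ c); rewrite z0 ?(lin0 (lr _ _)).
- move=> s u v bu bv.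
  apply: ext (borcherdsP s _ _ _ _ _ _ bu bv); try by move=> x x'; exact: zA.
  + by move=> k l; rewrite (mode2_linear2 _ _ _ _ _ ll lr).
  + by move=> k l; rewrite (mode2_linear1 _ _ _ _ _ ll lr).
  + by move=> k l; rewrite (voa_linr hU) ll.
  + by move=> x x'; exact: zC.
  + by move=> x x'; exact: zC.
move=> s b sb n m k.
have [N HN] := voa_bounded hU.
have [Ja HJa] := divpow_eventually0 hU a; have [Jb HJb] := divpow_eventually0 hU b.
(* Beyond this bound the weight of the product of the divided powers is below N. *)
pose J := maxn (maxn Ja Jb) (absz (r + s - n - N)%R).+1.
apply: (twist_borcherds_homog hU hZ (J := J) w ra sb) => [j|j|t j q]; rewrite /J !geq_max.
- by move=> /andP[/andP[/HJa]].
- by move=> /andP[/andP[_ /HJb]].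
move=> /andP[_ tJ].
have := voa_grade hU (n + t%:Z) (divpow_grade hU j ra) (divpow_grade hU q sb).
by rewrite HN //; lia.
Qed.

Lemma twist_modes : vmodes (~~ c) (twist Z).
Proof.
split; [|exact: tr|exact: (twist_vacuum hU hZ)|exact: twist_borcherds].
by move=> k; split=> [w|a]; [exact: ll|exact: lr].
Qed.

(** Conjugation by (-1)^(L(0)) changes the sign of L(1), hence inverts
    e^(L(1)); for the coefficients this is the vanishing of the alternating
    sums of binomials. *)
Lemma twistK k a w : twist (twist Z) k a w = Z k a w.
Proof.
move: a; apply: (linear_eq_homog ds).
- exact: (twist_linl hU twist_modes).
- exact: (vm_linl hZ).
move=> r a ra; have [J' HJ'] := divpow_eventually0 hU a; pose J := J'.+1.
have {HJ'} HJ j : (J <= j)%N -> divpow j a = 0 by move=> /ltnW /HJ'.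
rewrite (twist_sum hU twist_modes _ _ ra HJ).
pose F (j q : nat) := ((-1) ^+ j * 'C(j + q, j)%:R) *: Z (k - (j + q)%N%:Z) (divpow (j + q) a) w.
have F0 j q : (J <= j)%N || (J <= q)%N -> F j q = 0.
  move=> jq; rewrite /F HJ ?(lin0 (vm_linl hZ _ _)) ?scaler0 //; lia.
transitivity (\sum_(j < J) \sum_(q < J) F j q).
  rewrite scaler_sumr; apply: eq_bigr => j _.
  have ajJ q : (J <= q)%N -> divpow q (divpow j a) = 0.
    by move=> Jq; rewrite (divpow_divpow hU) HJ ?scaler0 //; lia.
  rewrite (twist_sum hU hZ _ _ (divpow_grade hU j ra) ajJ) !scaler_sumr.
  apply: eq_bigr => q _; rewrite (divpow_divpow hU) (linZ (vm_linl hZ _ _)) !scalerA /F.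
  rewrite signB mulrA -expfzMl mulrNN mulr1 exp1rz mul1r [(q + j)%N]addnC.
  congr (_ *: Z _ _ _); lia.
rewrite -(sum2_box F0) (sum_trunc (n := 1) (F := fun p => sum2 p F)); last first.
- case=> // p _; rewrite /sum2.
  rewrite (eq_bigr (fun j : 'I_p.+2 => ((-1) ^+ j * 'C(p.+1, j)%:R) *:
    Z (k - p.+1%:Z) (divpow p.+1 a) w)); last first.
    by move=> j _; rewrite /F subnKC //; have := ltn_ord j; lia.
  by rewrite -scaler_suml alternating_binomials scale0r.
- by [].
by rewrite big_ord1 /sum2 big_ord1 /F /= divpow0 bin0 mul1r scale1r subr0.
Qed.

(** All terms of the twisted mode shift degrees by the same amount. *)
Lemma twist_graded (B : nat -> set M) (hB : forall s, is_subspace (B s)) :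
  (forall r t s v w, gr r v -> B s w ->
    int_ext B (s%:Z + if c then r - t - 1 else t + 1 - r) (Z t v w)) ->
  (forall r t s v w, gr r v -> B s w ->
    int_ext B (s%:Z + if ~~ c then r - t - 1 else t + 1 - r) (twist Z t v w)).
Proof.
move=> grZ r t s v w rv sw.
have sub i : is_subspace (int_ext B i).
  case: i => // i; split=> //= a u x -> ->; by rewrite scaler0 addr0.
have [J HJ] := divpow_eventually0 hU v; rewrite (twist_sum hU hZ _ _ rv HJ).
apply: subspaceZ => //; apply: big_ind => [|u x|j _].
- by have [] := sub (s%:Z + if ~~ c then r - t - 1 else t + 1 - r).
- exact: subspaceD.
have := grZ _ (2 * r - t - 2 - j%:Z) _ _ _ (divpow_grade hU j rv) sw.
rewrite (_ : s%:Z + (if c then _ else _) = s%:Z + if ~~ c then r - t - 1 else t + 1 - r) //.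
by case: (c) => /=; lia.
Qed.

End TwistModes.

(** * Contractions of tensors *)

Section Contractions.
Context (K : numFieldType).
Implicit Types V W X : lmodType K.

Lemma tensor_lin_eq V W X (f g : tensor V W -> X) : linear f -> linear g ->
  (forall v w, f (v ⊗ w) = g (v ⊗ w)) -> f =1 g.
Proof.
move=> lf lg fg; apply: tensor_ind => //; first by rewrite !lin0.
by move=> a u v fu fv; rewrite lf lg fu fv.
Qed.

Lemma contractlE V W (f : {scalar V}) v w : contractl W f (v ⊗ w) = f v *: w.
Proof. exact: tliftE. Qed.

Lemma contractrE V W (f : {scalar V}) v w : contractr W f (w ⊗ v) = f v *: w.
Proof. exact: tliftE. Qed.

Lemma tswapE V W (v : V) (w : W) : tswap V W (v ⊗ w) = w ⊗ v.
Proof. exact: tliftE. Qed.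

Lemma contractl_lin V W (f : {scalar V}) : linear (contractl W f).
Proof. exact: linearP. Qed.

Lemma contractlP V W (f g h : {scalar V}) a t : (forall v, f v = a * g v + h v) ->
  contractl W f t = a *: contractl W g t + contractl W h t.
Proof.
move=> fgh; move: t; apply: tensor_lin_eq.
- exact: contractl_lin.
- move=> b s t; rewrite !contractl_lin !scalerDr !scalerA [a * b]mulrC !addrA.
  by congr (_ + _); rewrite addrAC.
- by move=> v w; rewrite !contractlE fgh scalerDl scalerA.
Qed.

Lemma eq_contractl V W (f g : {scalar V}) t : f =1 g ->
  contractl W f t = contractl W g t.
Proof.
move=> fg; move: t; apply: tensor_lin_eq; try exact: contractl_lin.
by move=> v w; rewrite !contractlE fg.
Qed.

Lemma contractl_pair V W (f : {scalar V}) (g : {scalar W}) t :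
  g (contractl W f t) = tpair f g t.
Proof.
move: t; apply: (@tensor_lin_eq _ _ K^o).
- by move=> a s t; rewrite !linearP.
- by move=> a s t; rewrite !linearP.
by move=> v w; rewrite contractlE tpairE linearZ.
Qed.

Lemma contractr_pair V W (f : {scalar V}) (g : {scalar W}) t :
  f (contractr V g t) = tpair f g t.
Proof.
move: t; apply: (@tensor_lin_eq _ _ K^o).
- by move=> a s t; rewrite !linearP.
- by move=> a s t; rewrite !linearP.
by move=> v w; rewrite contractrE tpairE linearZ mulrC.
Qed.

Lemma contractl_map V W V' W' (d : {linear V -> V'}) (h : {linear W -> W'})
    (f : {scalar V'}) (g : {scalar V}) t : (forall v, f (d v) = g v) ->
  contractl W' f (tmap d h t) = h (contractl W g t).
Proof.
move=> fg; move: t; apply: tensor_lin_eq.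
- by move=> a s t; rewrite !linearP.
- by move=> a s t; rewrite !linearP.
by move=> v w; rewrite tmapE !contractlE fg linearZ.
Qed.

(** (f \otimes g \otimes Id), applied one factor at a time. *)
Definition contract2 V W (f g : {scalar V}) (t : tensor (tensor V V) W) : W :=
  contractl W g (tmap (contractl V f) idfun t).

Lemma contract2_lin V W (f g : {scalar V}) : linear (@contract2 V W f g).
Proof. by move=> a s t; rewrite /contract2 !linearP. Qed.

Lemma contract2_assoc V W (f g : {scalar V}) (h : {linear W -> tensor V W}) t :
  contract2 f g (tassoc V V W (tmap idfun h t)) = contractl W g (h (contractl W f t)).
Proof.
move: t; apply: tensor_lin_eq.
- by move=> a s t; rewrite !linearP contract2_lin.
- by move=> a s t; rewrite !linearP.
move=> v w; rewrite tmapE contractlE !(linZ (linearP _)) [tassoc _ _ _ _]tliftE.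
rewrite /tassoc_pre; move: (h w).
apply: tensor_lin_eq.
- by move=> a s t; rewrite !linearP contract2_lin.
- by move=> a s t; rewrite !linearP.
move=> u x; rewrite tmapE /contract2 tmapE !contractlE.
by rewrite linearZ /= scalerA.
Qed.

Lemma contract2_swap V W (f g : {scalar V}) (h : {linear W -> tensor V W}) t :
  contract2 f g (tmap (tswap V V) idfun (tassoc V V W (tmap idfun h t)))
  = contractl W f (h (contractl W g t)).
Proof.
move: t; apply: tensor_lin_eq.
- by move=> a s t; rewrite !linearP contract2_lin.
- by move=> a s t; rewrite !linearP.
move=> v w; rewrite tmapE contractlE !(linZ (linearP _)) [tassoc _ _ _ _]tliftE.
rewrite /tassoc_pre; move: (h w).
apply: tensor_lin_eq.
- by move=> a s t; rewrite !linearP contract2_lin.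
- by move=> a s t; rewrite !linearP.
move=> u x; rewrite !tmapE tswapE /contract2 tmapE !contractlE.
by rewrite linearZ /= !scalerA mulrC.
Qed.

Lemma contract2_map V W (f g : {scalar V}) (d : {linear V -> tensor V V})
    (h : {scalar V}) t : (forall v, h v = tpair f g (d v)) ->
  contract2 f g (tmap d idfun t) = contractl W h t.
Proof.
move=> hE; move: t; apply: tensor_lin_eq.
- by move=> a s t; rewrite !linearP contract2_lin.
- exact: contractl_lin.
by move=> v w; rewrite /contract2 !tmapE !contractlE /= contractl_pair hE.
Qed.

End Contractions.

(** * Right modes of a comodule *)

Section DualModes.
Context (K : numFieldType) (V : gvoc K).
Local Notation V' := (gdual (voc_gr V)).
Local Notation gr := (voc_gr V).
Local Notation c := (voc_counit V).
Local Notation rho := (voc_rho V).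
Local Notation Delta := (voc_Delta V).
Local Notation rst := (@Defs.restrict K V).
Implicit Types f g h : V'.

Let ds : direct_sum gr := gvc_direct_sum (voc_graded V).
Let coalg := gvc_coalgebra (voc_graded V).

Lemma gdual_eq f g : f =1 g -> f = g.
Proof. by move=> fg; apply: val_inj; apply/funext => v; exact: fg. Qed.

Lemma gdualP a f g v : (a *: f + g) v = a * f v + g v.
Proof. by []. Qed.

Lemma gdual_lin f : linear (f : V -> K^o).
Proof. exact: gdual_linear. Qed.

Lemma gdual_grP s f v : gdual_gr s f -> f v = f (component gr s v).
Proof.
move=> fs; move: v; apply: (linear_eq_homog (X := K^o) ds).
- exact: gdual_linear.
- by move=> a u v; rewrite component_linear // gdual_linear.
move=> t v vt; rewrite (component_eq ds s vt); case: eqP => [//|st].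
by rewrite [RHS]linear0; apply: fs vt; apply/eqP => ts; exact: st.
Qed.

(** These are the modes of a right module: by co-Jacobi, composing coactions
    applies the functional of the first tensor factor first. *)
Definition comode (M : lmodType K) (DeltaM : int -> {linear M -> tensor V M}) (k : int)
  (f : dual_voa V) (m : M) : M := contractl M (f : V') (DeltaM k m).

Lemma dual_modeE k f g v : dual_mode k f g v = g (comode Delta k f v).
Proof. by rewrite /comode contractl_pair. Qed.

Section Comodes.
Context (M : lmodType K) (DeltaM : int -> {linear M -> tensor V M}).
Hypotheses (trM : truncated DeltaM) (jacM : co_jacobi Delta DeltaM).

Lemma comode_linr k f : linear (comode DeltaM k f).
Proof. by move=> a u v; rewrite /comode !linearP. Qed.

Lemma comode_linl k m : linear (comode DeltaM k ^~ m).
Proof. by move=> a u v; rewrite /comode (contractlP (g := u) (h := v) (a := a)). Qed.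

(** Contracting the co-Jacobi identity with f \otimes g \otimes Id. *)
Lemma comode_borcherds f g m :
  borcherds (fun k l => comode DeltaM l g (comode DeltaM k f m))
            (fun k l => comode DeltaM k f (comode DeltaM l g m))
            (fun k l => comode DeltaM l (dual_mode k f g) m).
Proof.
have [N HN] := trM m.
have jac := (borcherds20P _ _ _).1 (fun n => jacM m n).
have := borcherds_lin _ _ _ (@contract2_lin _ _ _ f g) jac.
rewrite (_ : (fun k l => contract2 f g (tassoc _ _ _ _))
  = fun k l => comode DeltaM l g (comode DeltaM k f m)); last first.
  by apply/funext => k; apply/funext => l; rewrite contract2_assoc.
rewrite (_ : (fun k l => contract2 f g (tmap (tswap _ _) _ _))
  = fun k l => comode DeltaM k f (comode DeltaM l g m)); last first.
  by apply/funext => k; apply/funext => l; rewrite contract2_swap.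
rewrite (_ : (fun k l => contract2 f g (tmap (Delta k) _ _))
  = fun k l => comode DeltaM l (dual_mode k f g) m); last first.
  apply/funext => k; apply/funext => l.
  exact: (contract2_map (h := dual_mode k f g)).
apply=> x y.
- by exists (absz (x - N)).+1 => j jx; rewrite HN ?linear0 //; lia.
- by exists (absz (y - N)).+1 => j jx; rewrite HN ?linear0 //; lia.
- by exists (absz (y - N)).+1 => j jx; rewrite HN ?linear0 //; lia.
Qed.

End Comodes.

Lemma restrict_grade s (f : {scalar V}) : gdual_gr s (rst s f).
Proof.
move=> t v ts vt; rewrite /= /restrict_fun (component_eq ds s vt).
by rewrite eq_sym (negbTE ts) linear0.
Qed.

Lemma restrictE s (f : {scalar V}) v : rst s f v = f (component gr s v).
Proof. by []. Qed.

Lemma restrict_scalarE s (f : {scalar V}) v :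
  (rst s f : {scalar V}) v = f (component gr s v).
Proof. by []. Qed.

(** In a tensor of degree t, the factors that accompany a vector of degree i have
    degree t - i. *)
Lemma component_contractl i t (f : {scalar V}) u : tensor_grade id gr gr t u ->
  component gr i (contractl V f u) = contractl V (rst (t - i) f) u.
Proof.
move: u; apply: linspan_ind.
- by rewrite !linear0 (lin0 (component_linear ds i)).
- move=> a u v hu hv.
  by rewrite contractl_lin (component_linear ds) hu hv contractl_lin.
move=> _ [j [v [w [vj wj ->]]]]; rewrite !contractlE (linZ (component_linear ds i)).
rewrite (component_eq ds _ wj) restrict_scalarE (component_eq ds _ vj).
case: (i =P j) => [->|ij]; first by rewrite eqxx.
case: eqP => [e|_]; first by case: ij; lia.
by rewrite (linear0 f) scale0r scaler0.
Qed.

Lemma scalar_restrict s (f : {scalar V}) :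
  (forall t v, t != s -> gr t v -> f v = 0) -> f =1 rst s f.
Proof.
move=> f0; apply: (linear_eq_homog (X := K^o) ds).
- exact: (linearP f).
- by move=> a u v; rewrite !restrictE (component_linear ds) linearP.
move=> t v vt; rewrite restrictE (component_eq ds _ vt).
by case: eqP => [//|/eqP st]; rewrite linear0 (f0 t) // eq_sym.
Qed.

(** The counit has degree 0: its other components c_j satisfy
    (c_j \otimes Id) Y(z) = 0, because (c \otimes Id) Y(z) preserves degrees, and
    contracting with c on the right returns c_j. *)
Lemma counit_restrict : c =1 rst 0 c.
Proof.
apply: scalar_restrict => j v j0 vj.
have z : contractl V (rst j c) (Delta (-1) v) = 0.
  have := component_contractl 0 c (gvc_graded (voc_graded V) (k := -1) vj).
  rewrite addrNK subr0 => <-.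
  rewrite (vc_counitl coalg) eqxx (component_eq ds _ vj).
  by rewrite eq_sym (negbTE j0).
have : rst j c v = 0.
  rewrite -[v in LHS](vc_counitr_lim coalg) [LHS]contractr_pair -contractl_pair z.
  exact: linear0.
by rewrite restrictE (component_eq ds _ vj) eqxx.
Qed.

Lemma voc_L_virasoro k j x :
  voc_L V k (voc_L V j x) - voc_L V j (voc_L V k x)
  = (k - j)%:~R *: voc_L V (k + j) x
    + (if k + j == 0 then (k ^+ 3 - k)%:~R / 12%:R * voc_rank V else 0) *: x.
Proof. exact: voc_virasoro. Qed.

(** Likewise rho has degree 2, because (rho \otimes Id) Delta_(-1) = L(2) lowers
    degrees by 2. *)
Lemma rho_restrict : rho =1 rst 2 rho.
Proof.
apply: scalar_restrict => j v j2 vj.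
have L2 : gr (j - 2) (voc_L V 2 v).
  rewrite voc_eigenspace.
  have L0 : voc_L V 0 v = j%:~R *: v by move: vj; rewrite voc_eigenspace.
  have := voc_L_virasoro 0 2 v; rewrite L0 (linZ (linearP (voc_L V 2))).
  move=> /(canRL (subrK _)); rewrite addr0.
  change (voc_L V 0 (voc_L V 2 v) = (0 - 2)%:~R *: voc_L V 2 v + 0 *: v
    + j%:~R *: voc_L V 2 v -> voc_L V 0 (voc_L V 2 v) = (j - 2)%:~R *: voc_L V 2 v).
  move=> ->; rewrite scale0r addr0 -scalerDl -rmorphD /=; congr (_%:~R *: _); lia.
have z : contractl V (rst j rho) (Delta (-1) v) = 0.
  have := component_contractl 0 rho (gvc_graded (voc_graded V) (k := -1) vj).
  rewrite addrNK subr0 => <-.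
  have -> : contractl V rho (Delta (-1) v) = voc_L V 2 v by [].
  rewrite (component_eq ds _ L2); case: eqP => // e.
  by move/eqP: j2; case; lia.
have : rst j rho v = 0.
  rewrite -[v in LHS](vc_counitr_lim coalg) [LHS]contractr_pair -contractl_pair z.
  exact: linear0.
by rewrite restrictE (component_eq ds _ vj) eqxx.
Qed.

End DualModes.

(** * Finite dimensional subspaces and the graded dual *)

Section Bases.
Context (K : fieldType) (V : lmodType K).
Implicit Types (A G : set V) (s t : seq V).

Lemma linspan_gen G : G `<=` linspan G.
Proof. exact: sub_gen_smallest. Qed.

Lemma linspan_min G A : is_subspace A -> G `<=` A -> linspan G `<=` A.
Proof. exact: smallest_sub. Qed.

Lemma subspace_sum A I r (P : pred I) (F : I -> V) : is_subspace A ->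
  (forall i, P i -> A (F i)) -> A (\sum_(i <- r | P i) F i).
Proof. by move=> sA FA; apply: big_ind => //; [exact: sA.1|move=> u v; exact: subspaceD]. Qed.

Lemma linspan_seqP t v :
  linspan [set` t] v <-> exists c : nat -> K, v = \sum_(i < size t) c i *: t`_i.
Proof.
split=> [|[c ->]].
  move: v; apply: linspan_ind.
  - by exists (fun=> 0); rewrite big1 // => i _; rewrite scale0r.
  - move=> a u v [c ->] [d ->]; exists (fun i => a * c i + d i).
    rewrite scaler_sumr -big_split; apply: eq_bigr => i _.
    by rewrite scalerDl scalerA.
  - move=> x /= xt; exists (fun i => (i == index x t)%:R).
    have ix : (index x t < size t)%N by rewrite index_mem.
    rewrite (bigD1 (Ordinal ix)) //= eqxx scale1r nth_index // big1 ?addr0 //.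
    by move=> i; rewrite -val_eqE /= => /negbTE ->; rewrite scale0r.
apply: subspace_sum => [|i _]; first exact: linspan_subspace.
apply: (subspaceZ _ (linspan_subspace _)).
by apply: linspan_gen; rewrite /= mem_nth.
Qed.

(** Elements that depend on their successors are dropped one at a time. *)
Lemma linspan_basis s : exists t, linspan [set` t] = linspan [set` s] /\
  forall c : nat -> K, \sum_(i < size t) c i *: t`_i = 0 ->
    forall i, (i < size t)%N -> c i = 0.
Proof.
elim: s => [|x s [t [ts tfree]]]; first by exists [::]; split.
have [tx|ntx] := pselect (linspan [set` t] x).
  exists t; split=> //; apply/seteqP; split.
    rewrite ts; apply: linspan_min; first exact: linspan_subspace.
    by move=> y /= ys; apply: linspan_gen; rewrite /= inE ys orbT.
  apply: linspan_min; first exact: linspan_subspace.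
  move=> y /=; rewrite inE => /orP[/eqP -> //|ys].
  by rewrite ts; exact: linspan_gen.
exists (x :: t); split.
  have sub1 r : linspan [set` r] `<=` linspan [set` x :: r].
    apply: linspan_min; first exact: linspan_subspace.
    by move=> y /= yr; apply: linspan_gen; rewrite /= inE yr orbT.
  apply/seteqP; split; (apply: linspan_min; first exact: linspan_subspace);
    move=> y /=; rewrite inE => /orP[/eqP ->|yt];
    try (by apply: linspan_gen; rewrite /= inE eqxx); apply: sub1.
    by rewrite -ts; exact: linspan_gen.
  by rewrite ts; exact: linspan_gen.
move=> c; rewrite /= big_ord_recl /= => /eqP; rewrite addr_eq0 => /eqP e.
have c0 : c 0%N = 0.
  apply/eqP/negP => /negP c0; apply: ntx; apply/linspan_seqP.
  exists (fun i => - (c 0%N)^-1 * c i.+1).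
  rewrite -[x](scalerK c0) e scalerN -scaleNr scaler_sumr.
  by apply: eq_bigr => i _; rewrite scalerA.
case=> [//|i]; rewrite ltnS => it; apply: (tfree (fun i => c i.+1)) it.
by apply/eqP; rewrite -oppr_eq0 -e c0 scale0r.
Qed.

(** Composed with the projection onto a graded piece, these coordinates become
    functionals on the whole space. *)
Lemma findim_coordinates A : findim A ->
  exists n (e : nat -> V) (eps : nat -> V -> K),
  [/\ forall i, A (e i),
      forall i a u v, A u -> A v -> eps i (a *: u + v) = a * eps i u + eps i v
    & forall v, A v -> v = \sum_(i < n) eps i v *: e i].
Proof.
move=> [s As]; have [t [ts tfree]] := linspan_basis s; rewrite -ts in As.
have sA : is_subspace A by rewrite As; exact: linspan_subspace.
have /choice[co coP] : forall v, exists c : nat -> K,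
    A v -> v = \sum_(i < size t) c i *: t`_i.
  move=> v; have [Av|nAv] := pselect (A v); last by exists (fun=> 0).
  by move: Av; rewrite As => /linspan_seqP[c e]; exists c.
exists (size t), (fun i => t`_i), (fun i v => if (i < size t)%N then co v i else 0); split.
- move=> i; case: (ltnP i (size t)) => it; last by rewrite nth_default //; exact: sA.1.
  by rewrite As; apply: linspan_gen; rewrite /= mem_nth.
- move=> i a u v Au Av; case: ifP => it; last by rewrite mulr0 addr0.
  have Auv := sA.2 a u v Au Av; apply/eqP; rewrite -subr_eq0; apply/eqP.
  apply: (tfree (fun i => co (a *: u + v) i - (a * co u i + co v i))) it.
  under eq_bigr do rewrite scalerBl scalerDl -scalerA.
  by rewrite sumrB big_split /= -scaler_sumr -!coP // subrr.
- move=> v Av; rewrite {1}(coP v Av); apply: eq_bigr => i _.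
  by rewrite ltn_ord.
Qed.

End Bases.

Section DualVoa.
Context (K : numFieldType) (V : gvoc K).
Local Notation V' := (gdual (voc_gr V)).
Local Notation gr := (voc_gr V).
Local Notation c := (voc_counit V).
Local Notation rho := (voc_rho V).
Local Notation Delta := (voc_Delta V).
Local Notation rst := (@Defs.restrict K V).
Implicit Types f g h : V'.

Let ds : direct_sum gr := gvc_direct_sum (voc_graded V).
Let coalg := gvc_coalgebra (voc_graded V).

(** The expansion of the identity of V_s as a sum of e_i \otimes e_i^*. *)
Lemma dual_basis s : exists n (e : nat -> V) (eps : nat -> V'),
  [/\ forall i, gr s (e i), forall i, gdual_gr s (eps i)
    & forall v, gr s v -> v = \sum_(i < n) eps i v *: e i].
Proof.
have [n [e [eps [es lin co]]]] := findim_coordinates (gvc_findim (voc_graded V) s).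
have grc v : gr s (component gr s v) by have [] := componentP ds v.
have ep i : (fun v => eps i (component gr s v) : K^o) \in gdual_pred gr.
  apply/asboolP; split=> [a u v|].
    by rewrite (component_linear ds) lin.
  apply: (sub_finite_set _ (finite_set1 s)) => t [v tv]; apply: contra_neqP => ts.
  rewrite (component_eq ds _ tv) eq_sym (introF eqP ts).
  have s0 := (ds.1 s).1; have := lin i (-1) 0 0 s0 s0.
  by rewrite scaler0 addr0 mulN1r addNr.
exists n, e, (fun i => Gdual (ep i)); split=> //.
- move=> i t v ts tv; rewrite /= (component_eq ds _ tv) eq_sym (negbTE ts).
  have s0 := (ds.1 s).1; have := lin i (-1) 0 0 s0 s0.
  by rewrite scaler0 addr0 mulN1r addNr.
- move=> v sv; rewrite {1}(co v sv); apply: eq_bigr => i _ /=.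
  by rewrite (component_eq ds _ sv) eqxx.
Qed.

Lemma dual_basis_expand s n (e : nat -> V) (eps : nat -> V') :
  (forall i, gdual_gr s (eps i)) ->
  (forall v, gr s v -> v = \sum_(i < n) eps i v *: e i) ->
  forall f, gdual_gr s f -> f = \sum_(i < n) f (e i) *: eps i.
Proof.
move=> es co f fs; apply: gdual_eq => v.
have evl : linear (fun g : V' => g v : K^o) by [].
rewrite (lin_sum evl) (gdual_grP _ fs).
have sv : gr s (component gr s v) by have [] := componentP ds v.
rewrite (co _ sv) (lin_sum (gdual_lin f)); apply: eq_bigr => i _.
rewrite (linZ (gdual_lin f)) (linZ evl) -(gdual_grP v (es i)); exact: mulrC.
Qed.

Lemma dual_direct_sum : direct_sum (@gdual_gr K V gr).
Proof.
split=> [s|f].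
  split=> [t v _ _ //|a f g fs gs t v ts tv].
  by rewrite gdualP (fs _ _ ts tv) (gs _ _ ts tv) mulr0 addr0.
have fin : finite_set [set i | rst i f != 0].
  apply: sub_finite_set (gdual_finite f) => s /= fs; apply: contrapT => nv.
  move/eqP: fs; apply; apply: gdual_eq => v.
  apply/eqP/negP => /negP fv; apply: nv; exists (component gr s v) => //.
  by have [] := componentP ds v.
have evl v : linear (fun g : V' => g v : K^o) by [].
exists (fun s => rst s f); split.
  split=> //; first by move=> s; exact: restrict_grade.
  apply: gdual_eq => v; rewrite (fsum_lin (evl v) fin).
  have [fv _ {1}->] := componentP ds v.
  by rewrite (fsum_lin (gdual_lin f) fv).
move=> x [fx Wx fE]; apply/funext => s; apply: gdual_eq => v.
rewrite -[LHS]/(f (component gr s v)) fE.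
set w := component gr s v.
have sw : gr s w by have [] := componentP ds v.
rewrite (fsum_lin (evl w) fx) (fsum_single (i := s)); first by rewrite (gdual_grP v (Wx s)).
by move=> i si; apply: Wx sw; rewrite eq_sym.
Qed.

Lemma dual_findim s : findim (@gdual_gr K V gr s).
Proof.
have [n [e [eps [es epss co]]]] := dual_basis s.
exists (mkseq eps n); apply/seteqP; split.
  move=> f fs; rewrite (dual_basis_expand epss co fs).
  apply: subspace_sum => [|i _]; first exact: linspan_subspace.
  apply: (subspaceZ _ (linspan_subspace _)).
  by apply: linspan_gen => /=; apply: map_f; rewrite mem_iota add0n ltn_ord.
apply: linspan_min; first exact: (dual_direct_sum.1 s).
by move=> f /= /mapP[i _ ->].
Qed.

Lemma dual_bounded : exists N : int, forall s, s < N -> @gdual_gr K V gr s = [set 0].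
Proof.
have [N HN] := gvc_bounded (voc_graded V); exists N => s sN.
apply/seteqP; split=> [f fs|_ -> t v _ _ //].
apply: gdual_eq => v; rewrite (gdual_grP _ fs).
have : gr s (component gr s v) by have [] := componentP ds v.
by rewrite HN // => ->; rewrite linear0.
Qed.

End DualVoa.

(** * The dual vertex operator algebra *)

Section DualIsVoa.
Context (K : numFieldType) (V : gvoc K).
Local Notation V' := (gdual (voc_gr V)).
Local Notation gr := (voc_gr V).
Local Notation c := (voc_counit V).
Local Notation rho := (voc_rho V).
Local Notation Delta := (voc_Delta V).
Local Notation rst := (@Defs.restrict K V).
Implicit Types f g h : V'.

Let ds : direct_sum gr := gvc_direct_sum (voc_graded V).
Let coalg := gvc_coalgebra (voc_graded V).
Let dsd := @dual_direct_sum K V.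

Lemma dual_linl k g : linear (fun f => dual_mode k f g).
Proof.
move=> a u v; apply: gdual_eq => x; rewrite gdualP !dual_modeE.
by rewrite (comode_linl Delta) gdual_linear.
Qed.

Lemma dual_linr k f : linear (dual_mode k f).
Proof. by move=> a u v; apply: gdual_eq => x; rewrite gdualP !dual_modeE gdualP. Qed.

Lemma dual_grade r s k f g : gdual_gr r f -> gdual_gr s g ->
  gdual_gr (r + s - k - 1) (dual_mode k f g).
Proof.
move=> fr gs t v tne tv; rewrite [LHS]/(tpair f g (Delta k v)).
move: (gvc_graded (voc_graded V) (k := k) tv).
apply: (linspan_ind (P := fun u => tpair f g u = 0)); first exact: linear0.
  by move=> a u u' u0 u0'; rewrite linearP u0 u0' scaler0 addr0.
move=> _ [i [x [w [xi wi ->]]]]; rewrite tpairE.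
have [si|si] := eqVneq i s; last by rewrite [X in _ * X](gs i w) // mulr0.
rewrite [X in X * _](fr (t + k + 1 - i) x) ?mul0r //.
by apply: contra_neq tne => <-; rewrite si; lia.
Qed.

Lemma dual_truncated f g : exists T : int, forall t, T <= t -> dual_mode t f g = 0.
Proof.
have [N HN] := dual_bounded V.
move: f; apply: (direct_sum_ind dsd).
- by exists 0 => t _; exact: lin0 (dual_linl t g).
- move=> a u v [T HT] [T' HT']; exists (Num.max T T') => t.
  by rewrite ge_max dual_linl => /andP[/HT -> /HT' ->]; rewrite scaler0 addr0.
move=> r f fr; move: g; apply: (direct_sum_ind dsd).
- by exists 0 => t _; exact: lin0 (dual_linr t f).
- move=> a u v [T HT] [T' HT']; exists (Num.max T T') => t.
  by rewrite ge_max dual_linr => /andP[/HT -> /HT' ->]; rewrite scaler0 addr0.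
move=> s g gs; exists (r + s - N) => t tT.
by have := dual_grade (k := t) fr gs; rewrite HN //; lia.
Qed.

Lemma comode_vacuum (M : lmodType K) (DeltaM : int -> {linear M -> tensor V M}) k m :
  comode DeltaM k (rst 0 c) m = contractl M c (DeltaM k m).
Proof. by apply: eq_contractl => v; rewrite counit_restrict. Qed.

Lemma comode_omega (M : lmodType K) (DeltaM : int -> {linear M -> tensor V M}) k m :
  comode DeltaM k (rst 2 rho) m = coL rho DeltaM (1 - k) m.
Proof.
rewrite /coL /= (_ : 1 - (1 - k) = k); last lia.
by apply: eq_contractl => v; rewrite rho_restrict.
Qed.

(** The action on V' is the transpose of the right modes of V acting on itself;
    transposing restores the order of composition of a left module. *)
Lemma dual_modes : vmodes true (@voa_Y K (dual_voa V)).
Proof.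
split.
- by move=> k; split=> [g|f]; [exact: dual_linl|exact: dual_linr].
- exact: dual_truncated.
- move=> g k; apply: gdual_eq => v.
  rewrite [LHS]dual_modeE comode_vacuum (vc_counitl coalg).
  by case: eqP => // _; rewrite linear0.
move=> f g h; have eventually0_dual a b x y : eventually0 (fun j : nat =>
    dual_mode (x - j%:Z) a (dual_mode (y + j%:Z) b h) : V').
  have [T HT] := dual_truncated b h; exists (absz (T - y)) => j Tj.
  by rewrite HT; [exact: lin0 (@dual_linr _ _)|lia].
apply: (@borcherds_separated K V' K^o _ _ _ _ _ _ V (fun v u => u v)) => [x y|x y|x y|//|u u0|v].
- exact: eventually0_dual.
- exact: eventually0_dual.
- have [T HT] := dual_truncated f g; exists (absz (T - x)) => j Tj.
  by rewrite [voa_Y _ f g]HT; [exact: lin0 (@dual_linl _ _)|lia].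
- by apply: gdual_eq => v; exact: u0.
have [N HN] := vc_truncated coalg v.
have bor := comode_borcherds (vc_truncated coalg) (vc_jacobi coalg) f g v.
have := borcherds_lin _ _ _ (gdual_lin h) bor.
rewrite (_ : (fun k l => h (comode Delta l g _))
  = fun k l => (mode2 true (@voa_Y K (dual_voa V)) f k g l h : V') v); last first.
  by apply/funext => k; apply/funext => l; rewrite /mode2 !dual_modeE.
rewrite (_ : (fun k l => h (comode Delta k f _))
  = fun k l => (mode2 true (@voa_Y K (dual_voa V)) g l f k h : V') v); last first.
  by apply/funext => k; apply/funext => l; rewrite /mode2 !dual_modeE.
rewrite (_ : (fun k l => h (comode Delta l _ _))
  = fun k l => (dual_mode l (dual_mode k f g) h : V') v); last first.
  by apply/funext => k; apply/funext => l; rewrite !dual_modeE.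
apply=> x y.
- exists (absz (x - N)).+1 => j jx; rewrite /comode [Delta _ v]HN ?linear0 //; lia.
- by exists (absz (y - N)).+1 => j jx; rewrite /comode [Delta _ v]HN ?linear0 //; lia.
- by exists (absz (y - N)).+1 => j jx; rewrite /comode [Delta _ v]HN ?linear0 //; lia.
Qed.

Lemma dual_LE k f v : @voa_L K (dual_voa V) k f v = f (voc_L V (- k) v).
Proof.
rewrite [LHS]dual_modeE comode_omega (_ : 1 - (k + 1) = - k) //; lia.
Qed.

Lemma dual_virasoro : virasoro (@voa_L K (dual_voa V)) (voc_rank V).
Proof.
move=> k j f; apply: gdual_eq => v.
have e := voc_L_virasoro (- j) (- k) v.
have -> : (@voa_L K (dual_voa V) k (@voa_L K (dual_voa V) j f)
  - @voa_L K (dual_voa V) j (@voa_L K (dual_voa V) k f) : V') v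
  = f (voc_L V (- j) (voc_L V (- k) v)) - f (voc_L V (- k) (voc_L V (- j) v)).
  by rewrite -!dual_LE.
rewrite -(linB (gdual_lin f)) e (linD (gdual_lin f)) !(linZ (gdual_lin f)).
rewrite (_ : - j - k = - (k + j)); last lia.
rewrite -dual_LE (_ : - j - - k = k - j); last lia.
rewrite oppr_eq0; congr (_ + _ * _); case: eqP => // kj.
have -> : j = - k by lia.
by rewrite opprK.
Qed.

Lemma dual_translation f k g :
  dual_mode k (@voa_L K (dual_voa V) (-1) f) g = (- k)%:~R *: dual_mode (k - 1) f g.
Proof.
apply: gdual_eq => v.
transitivity (g ((- k)%:~R *: comode Delta (k - 1) f v)); last first.
  by rewrite (linZ (gdual_lin g)) -dual_modeE.
rewrite dual_modeE; congr (gdual_fun g _).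
have := @voc_derivative K V v (- k - 1); rewrite /ser /dz.
rewrite (_ : - (- k - 1) - 1 = k); last lia.
rewrite (_ : - (- k - 1 + 1) - 1 = k - 1); last lia.
rewrite (_ : - k - 1 + 1 = - k); last lia.
move=> /(congr1 (contractl V f)); rewrite (linZ (contractl_lin _)) => <-.
apply: esym; apply: (@contractl_map K V V V V (voc_L V 1) idfun f
  (@voa_L K (dual_voa V) (-1) f : V')) => x.
by rewrite [RHS]dual_LE opprK.
Qed.

Lemma dual_creation k f v :
  (dual_mode k f (rst 0 c) : V') v = f (contractr V c (Delta k v)).
Proof.
transitivity (c (comode Delta k f v)).
  by rewrite dual_modeE; exact/esym/counit_restrict.
by rewrite /comode contractl_pair -contractr_pair.
Qed.

Lemma dual_is_voa : is_voa (dual_voa V).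
Proof.
split.
- exact: dual_direct_sum.
- exact: dual_findim.
- exact: dual_bounded.
- exact/weak_moduleP/dual_modes.
- move=> f k k0; apply: gdual_eq => v.
  by rewrite [LHS]dual_creation (vc_counitr_reg coalg) // linear0.
- move=> f; apply: gdual_eq => v.
  by rewrite [LHS]dual_creation (vc_counitr_lim coalg).
- exact: restrict_grade.
- exact: restrict_grade.
- by exists (voc_rank V); exact: dual_virasoro.
- move=> s f fs; apply: gdual_eq => v.
  have sv : gr s (component gr s v) by have [] := componentP ds v.
  rewrite (gdual_grP v (_ : gdual_gr s _)); last first.
    rewrite (_ : s = 2 + s - 1 - 1); last lia.
    by apply: dual_grade => //; exact: restrict_grade.
  rewrite [LHS]dual_LE oppr0; move: sv; rewrite voc_eigenspace => /= ->.
  by rewrite (linZ (gdual_lin f)) -[RHS]/(_ * f v) (gdual_grP v fs).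
- move=> f g n; rewrite /ser /dz.
  rewrite [LHS]dual_translation (_ : - (- n - 1) = n + 1); last lia.
  by rewrite (_ : - n - 1 - 1 = - (n + 1) - 1); last lia.
Qed.

End DualIsVoa.

(** * Expansion of tensors in dual bases *)

Section Separation.
Context (K : numFieldType) (V : gvoc K).
Local Notation V' := (gdual (voc_gr V)).
Local Notation gr := (voc_gr V).

Let ds : direct_sum gr := gvc_direct_sum (voc_graded V).

Lemma dual_bases : exists (n : int -> nat) (e : int -> nat -> V) (eps : int -> nat -> V'),
  forall s, [/\ forall i, gr s (e s i), forall i, gdual_gr s (eps s i)
    & forall v, gr s v -> v = \sum_(i < n s) eps s i v *: e s i].
Proof.
have /choice[n /choice[e /choice[eps H]]] := dual_basis V.
by exists n, e, eps.
Qed.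

Section Bases.
Variables (n : int -> nat) (e : int -> nat -> V) (eps : int -> nat -> V').
Hypothesis be : forall s, [/\ forall i, gr s (e s i), forall i, gdual_gr s (eps s i)
    & forall v, gr s v -> v = \sum_(i < n s) eps s i v *: e s i].

Lemma dual_bases_component s v :
  component gr s v = \sum_(i < n s) eps s i v *: e s i.
Proof.
have [_ es co] := be s.
have sv : gr s (component gr s v) by have [] := componentP ds v.
by rewrite {1}(co _ sv); apply: eq_bigr => i _; rewrite -(gdual_grP v (es i)).
Qed.

Lemma pure_linl (M : lmodType K) (m : M) : linear (fun v : V => v ⊗ m).
Proof. by move=> a u v; exact: pureDl. Qed.

(** The component of a tensor in V_s \otimes M. *)
Definition tensor_part (M : lmodType K) s (t : tensor V M) : tensor V M :=
  \sum_(i < n s) e s i ⊗ contractl M (eps s i) t.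

Lemma tensor_part_pure (M : lmodType K) s v (m : M) :
  tensor_part s (v ⊗ m) = component gr s v ⊗ m.
Proof.
rewrite dual_bases_component (lin_sum (pure_linl m)); apply: eq_bigr => i _.
by rewrite contractlE (linZ (pure_linl m)) linearZ.
Qed.

Lemma tensor_part_linear (M : lmodType K) s : linear (@tensor_part M s).
Proof.
move=> a u v; rewrite /tensor_part scaler_sumr -big_split; apply: eq_bigr => i _ /=.
by rewrite contractl_lin pureDr.
Qed.

Lemma tensor_part_finite (M : lmodType K) (t : tensor V M) :
  finite_set [set s | tensor_part s t != 0].
Proof.
move: t; apply: tensor_ind => [|a u v fu fv|v m].
- exact: finite_support0 (@tensor_part_linear M).
- exact: finite_support_lin (@tensor_part_linear M) fu fv.
have [fv _ _] := componentP ds v; apply: sub_finite_set fv => s /=.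
by rewrite tensor_part_pure; apply: contra_neq => ->; exact: lin0 (pure_linl m).
Qed.

Lemma tensor_expand (M : lmodType K) (t : tensor V M) :
  t = \sum_(s \in [set: int]) tensor_part s t.
Proof.
move: t; apply: tensor_lin_eq => //.
  by apply: fsum_linear; [exact: tensor_part_linear|exact: tensor_part_finite].
move=> v m; under eq_fsbigr => s _ do rewrite tensor_part_pure.
have [fv _ {1}->] := componentP ds v.
exact: (fsum_lin (pure_linl m) fv).
Qed.

Lemma tensor2_expand (M : lmodType K) (t : tensor (tensor V V) M) :
  t = \sum_(s \in [set: int]) \sum_(i < n s)
        tmap (pure (e s i)) idfun (tmap (contractl V (eps s i)) idfun t).
Proof.
pose G s (t : tensor (tensor V V) M) := \sum_(i < n s)
  tmap (pure (e s i)) idfun (tmap (contractl V (eps s i)) idfun t).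
have pl (m : M) : linear (fun x : tensor V V => x ⊗ m) by move=> a u v; exact: pureDl.
have Gpure s x m : G s (x ⊗ m) = tensor_part s x ⊗ m.
  by rewrite (lin_sum (pl m)); apply: eq_bigr => i _; rewrite !tmapE.
have Glin s : linear (G s).
  move=> a u v; rewrite /G scaler_sumr -big_split; apply: eq_bigr => i _ /=.
  by rewrite !linearP.
have Gfin u : finite_set [set s | G s u != 0].
  move: u; apply: tensor_ind => [|a u v fu fv|x m].
  - exact: (finite_support0 Glin).
  - exact: (finite_support_lin a Glin fu fv).
  apply: sub_finite_set (tensor_part_finite x) => s /=.
  by rewrite Gpure; apply: contra_neq => ->; exact: lin0 (pl m).
rewrite -[RHS]/(\sum_(s \in [set: int]) G s t); move: t.
apply: tensor_lin_eq => //; first exact: fsum_linear.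
move=> x m; under eq_fsbigr => s _ do rewrite Gpure.
rewrite {1}(tensor_expand x); exact: (fsum_lin (pl m) (tensor_part_finite x)).
Qed.

End Bases.

(** A tensor is recovered from its contractions with dual bases of the V_s. *)
Lemma tensor_separated (M : lmodType K) (t : tensor V M) :
  (forall f : V', contractl M f t = 0) -> t = 0.
Proof.
have [n [e [eps be]]] := dual_bases => t0.
rewrite (tensor_expand be t) fsbig1 // => s _.
by rewrite /tensor_part big1 // => i _; rewrite t0 linear0.
Qed.

Lemma tensor2_separated (M : lmodType K) (t : tensor (tensor V V) M) :
  (forall fg : V' * V', contract2 fg.1 fg.2 t = 0) -> t = 0.
Proof.
have [n [e [eps be]]] := dual_bases => t0.
rewrite (tensor2_expand be t) fsbig1 // => s _.
rewrite big1 // => i _; rewrite [X in tmap _ _ X]tensor_separated ?linear0 // => g.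
exact: (t0 (eps s i, g)).
Qed.

End Separation.

(** * From comodules to modules *)

Section Gradings.
Context (K : numFieldType) (V : gvoc K) (M : lmodType K).
Context (DeltaM : int -> {linear M -> tensor V M}) (B : nat -> set M).
Hypothesis hB : direct_sum B.
Local Notation V' := (gdual (voc_gr V)).

Lemma int_ext_subspace s : is_subspace (int_ext B s).
Proof.
case: s => s; first exact: hB.1.
by split=> //= a u v -> ->; rewrite scaler0 addr0.
Qed.

Lemma int_ext_neg s : s < 0 -> int_ext B s = [set 0].
Proof. by case: s. Qed.

Lemma comode_graded :
  (forall k t m, B t m -> tensor_grade Posz (voc_gr V) B (t%:Z + k + 1) (DeltaM k m)) ->
  forall r k s f m, gdual_gr r f -> B s m ->
    int_ext B (s%:Z + (k + 1 - r)) (comode DeltaM k f m).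
Proof.
move=> gB r k s f m fr sm; have sub := int_ext_subspace.
move: (gB k s m sm); apply: (linspan_ind
  (P := fun u => int_ext B (s%:Z + (k + 1 - r)) (contractl M (f : V') u))).
- by rewrite linear0; exact: (sub _).1.
- by move=> a u v hu hv; rewrite contractl_lin; exact: (sub _).2.
move=> _ [i [v [x [vi xi ->]]]]; rewrite contractlE.
have [e|ne] := eqVneq (s%:Z + k + 1 - i%:Z) r.
  rewrite (_ : _ + _ = i%:Z); last lia.
  exact: subspaceZ (sub i%:Z) xi.
by rewrite [_ v](fr _ v ne vi) scale0r; exact: (sub _).1.
Qed.

End Gradings.

Section ComoduleToModule.
Context (K : numFieldType) (V : gvoc K) (M : lmodType K).
Context (DeltaM : int -> {linear M -> tensor V M}).
Local Notation V' := (gdual (voc_gr V)).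
Local Notation U := (dual_voa V).

Lemma comode_modes : weak_comodule DeltaM -> vmodes false (comode DeltaM : int -> U -> M -> M).
Proof.
move=> wc; split.
- by move=> k; split=> [m|f]; [exact: comode_linl|exact: comode_linr].
- move=> f m; have [N HN] := wc_truncated wc m; exists (1 - N) => t tN.
  rewrite /comode [DeltaM _ m]HN ?linear0 //; lia.
- by move=> m k; rewrite [LHS]comode_vacuum (wc_counit wc).
- exact: comode_borcherds (wc_truncated wc) (wc_jacobi wc).
Qed.

Lemma admissible_module_of_comodule : admissible_comodule DeltaM ->
  admissible_module (twist (comode DeltaM : int -> U -> M -> M)).
Proof.
move=> [wc [B [hB gB]]]; split.
  by apply/weak_moduleP; exact: (twist_modes (dual_is_voa V) (comode_modes wc)).
exists B; split=> // r t s f m fr sm.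
have := twist_graded (dual_is_voa V) (comode_modes wc) hB.1.
move=> /(_ (comode_graded hB gB) r t s f m fr sm) /=.
by rewrite (_ : s%:Z + (r - t - 1) = r + s%:Z - t - 1) //; lia.
Qed.

End ComoduleToModule.

(** * From modules to comodules *)

Lemma finite_absz L : finite_set [set s : int | (absz s <= L)%N].
Proof.
apply: (sub_finite_set (B := Posz @` `I_L.+1 `|` Negz @` `I_L.+1)).
  by case=> s /= sL; [left; exists s|right; exists s => //; exact: ltnW].
by rewrite finite_setU; split; apply: finite_image; exact: finite_II.
Qed.

Section ModuleToComodule.
Context (K : numFieldType) (V : gvoc K) (M : lmodType K).
Local Notation V' := (gdual (voc_gr V)).
Local Notation U := (dual_voa V).
Local Notation gr := (voc_gr V).
Context (R : int -> U -> M -> M) (hR : vmodes false R).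
Context (B : nat -> set M) (hB : direct_sum B).
Hypothesis gB : forall r k s f m, @gdual_gr K V gr r f -> B s m ->
  int_ext B (s%:Z + (k + 1 - r)) (R k f m).

Let ds : direct_sum gr := gvc_direct_sum (voc_graded V).
Let hU := dual_is_voa V.

(** For very negative s the piece V'_s is zero, and for large s a functional of
    weight s lowers degrees too much. Hence only finitely many V_s contribute to
    the coaction on a given vector. *)
Lemma right_vanish k m : exists L : nat, forall s f, (L < absz s)%N ->
  @gdual_gr K V gr s f -> R k f m = 0.
Proof.
have [N HN] := dual_bounded V.
move: m; apply: (direct_sum_ind hB).
- by exists 0%N => s f _ _; exact: lin0 (vm_linr hR _ _).
- move=> a u v [L HL] [L' HL']; exists (maxn L L') => s f.
  rewrite gtn_max => /andP[Ls L's] fs.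
  by rewrite (vm_linr hR) (HL _ _ Ls fs) (HL' _ _ L's fs) scaler0 addr0.
move=> t m mt; exists (absz N + absz (t%:Z + k + 1)%R)%N => s f Ls fs.
have [sN|sN] := ltP s N.
  by move: fs; rewrite HN // => ->; exact: lin0 (vm_linl hR _ _).
have := gB k fs mt.
rewrite int_ext_neg //; lia.
Qed.

Section Bases.
Variables (n : int -> nat) (e : int -> nat -> V) (eps : int -> nat -> V').
Hypothesis be : forall s, [/\ forall i, gr s (e s i), forall i, gdual_gr s (eps s i)
    & forall v, gr s v -> v = \sum_(i < n s) eps s i v *: e s i].

(** Contracting with f recovers R_k(f), because f is the sum of the f(e_i) e_i^*. *)
Definition coaction_part k s m : tensor V M := \sum_(i < n s) e s i ⊗ R k (eps s i) m.
Definition coaction_fun k m : tensor V M := \sum_(s \in [set: int]) coaction_part k s m.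

Lemma coaction_part_linear k s : linear (coaction_part k s).
Proof.
move=> a u v; rewrite /coaction_part scaler_sumr -big_split; apply: eq_bigr => i _ /=.
by rewrite (vm_linr hR) pureDr.
Qed.

Lemma coaction_part_finite k m : finite_set [set s | coaction_part k s m != 0].
Proof.
have [L HL] := right_vanish k m; apply: sub_finite_set (finite_absz L) => s /=.
apply: contra_neqT; rewrite -ltnNge => Ls; rewrite /coaction_part big1 // => i _.
have [_ es _] := be s.
by rewrite (HL s) // linear0.
Qed.

Lemma coaction_linear k : linear (coaction_fun k).
Proof.
by apply: fsum_linear; [exact: coaction_part_linear|exact: coaction_part_finite].
Qed.

Definition coaction (k : int) : {linear M -> tensor V M} :=
  HB.pack (coaction_fun k) (GRing.isLinear.Build K M (tensor V M) *:%R
    (coaction_fun k) (coaction_linear k)).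

Lemma comode_coaction k f m : comode coaction k f m = R k f m.
Proof.
move: f; apply: (linear_eq_homog (dual_direct_sum V)).
- exact: comode_linl.
- exact: vm_linl hR k m.
move=> r f fr; rewrite /comode.
have -> : coaction k m = coaction_fun k m by [].
rewrite (fsum_lin (contractl_lin _) (coaction_part_finite k m)).
have fe s i : s != r -> f (e s i) = 0 :> K.
  by move=> sr; have [es _ _] := be s; exact: fr sr (es i).
rewrite (fsum_single (i := r)) => [|s sr].
  rewrite (lin_sum (contractl_lin _)).
  have [_ es co] := be r; rewrite [in RHS](dual_basis_expand es co fr).
  rewrite (lin_sum (vm_linl hR _ _)); apply: eq_bigr => i _.
  by rewrite contractlE (linZ (vm_linl hR _ _)).
rewrite (lin_sum (contractl_lin _)) big1 // => i _.
by rewrite contractlE [X in X *: _](fe _ _ sr) scale0r.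
Qed.

Lemma coaction_graded k t m : B t m ->
  tensor_grade Posz gr B (t%:Z + k + 1) (coaction k m).
Proof.
move=> tm.
rewrite -[coaction k m]/(\sum_(s \in [set: int]) coaction_part k s m).
rewrite (fsbigTE (fset_set [set s | coaction_part k s m != 0])); last first.
  move=> s; rewrite in_fset_set ?inE; last exact: coaction_part_finite.
  by move=> /negP; rewrite inE /= => /negP /negPn /eqP.
apply: subspace_sum => [|s _]; first exact: linspan_subspace.
apply: subspace_sum => [|i _]; first exact: linspan_subspace.
have [es epss _] := be s; have := gB k (epss i) tm.
case jE : (t%:Z + (k + 1 - s)) => [j|j] => [Bj|/= ->]; last first.
  by rewrite linear0; exact: (linspan_subspace _).1.
apply: linspan_gen; exists j, (e s i), (R k (eps s i) m); split=> //.
by rewrite (_ : _ - _ = s) //; lia.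
Qed.

Lemma coaction_truncated : truncated coaction.
Proof.
move=> m; move: m; apply: (direct_sum_ind hB).
- by exists 0 => k _; rewrite linear0.
- move=> a u v [N HN] [N' HN']; exists (Num.min N N') => k.
  by rewrite lt_min linearP => /andP[/HN -> /HN' ->]; rewrite scaler0 addr0.
move=> t m mt; have [N HN] := dual_bounded V; exists (N - t%:Z - 1) => k kN.
rewrite -[LHS]/(coaction_fun k m) /coaction_fun fsbig1 // => s _.
rewrite /coaction_part big1 // => i _; have [_ es _] := be s.
suff -> : R k (eps s i) m = 0 by rewrite linear0.
have [sN|sN] := ltP s N.
  by move: (es i); rewrite HN // => ->; exact: lin0 (vm_linl hR _ _).
have := gB k (es i) mt; rewrite int_ext_neg //; lia.
Qed.

(** Contracted with f \otimes g \otimes Id, the co-Jacobi identity is Borcherds'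
    identity of the right module, and such contractions separate tensors. *)
Lemma coaction_jacobi : co_jacobi (voc_Delta V) coaction.
Proof.
move=> m; apply/borcherds20P.
have [N HN] := coaction_truncated m.
apply: (@borcherds_separated K _ M _ _ _ _ _ _ (V' * V')%type
  (fun fg => contract2 fg.1 fg.2)) => [x y|x y|x y|fg|t t0|[f g]].
- by exists (absz (x - N)).+1 => j jx; rewrite HN ?linear0 //; lia.
- by exists (absz (y - N)).+1 => j jx; rewrite HN ?linear0 //; lia.
- by exists (absz (y - N)).+1 => j jx; rewrite HN ?linear0 //; lia.
- exact: contract2_lin.
- exact: tensor2_separated t0.
have := vm_borcherds hR f g m.
set A := (X in borcherds X _ _); set A' := (X in borcherds _ X _).
set A'' := (X in borcherds _ _ X).
rewrite (_ : A = fun k l => contract2 f g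
    (tassoc V V M (tmap idfun (coaction l) (coaction k m)))); last first.
  apply/funext => k; apply/funext => l; rewrite contract2_assoc.
  by rewrite /A /mode2 -!comode_coaction.
rewrite (_ : A' = fun k l => contract2 f g (tmap (tswap V V) idfun
    (tassoc V V M (tmap idfun (coaction k) (coaction l m))))); last first.
  apply/funext => k; apply/funext => l; rewrite contract2_swap.
  by rewrite /A' /mode2 -!comode_coaction.
rewrite (_ : A'' = fun k l => contract2 f g (tmap (voc_Delta V k) idfun (coaction l m))) //.
apply/funext => k; apply/funext => l.
rewrite (contract2_map (h := dual_mode k f g)) // /A'' -comode_coaction.
by [].
Qed.

Lemma coaction_coL k m : coL (voc_rho V) coaction k m = R (1 - k) (@voa_omega K U) m.
Proof. by rewrite -comode_coaction [RHS]comode_omega (_ : 1 - (1 - k) = k) //; lia. Qed.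

Lemma coaction_virasoro : virasoro (coL (voc_rho V) coaction) (voc_rank V).
Proof.
move=> k j m; rewrite !coaction_coL.
have := vm_virasoro hU (1 - j) (1 - k) m hR (@dual_virasoro K V).
rewrite /mode2 => ->.
have -> : 1 - j + (1 - k) - 1 = 1 - (k + j) by lia.
have -> : (1 - j + (1 - k) == 2) = (k + j == 0) by apply/eqP/eqP; lia.
have -> : 1 - j - (1 - k) = k - j by lia.
case: eqP => // kj; have -> : 1 - j - 1 = k by lia.
by [].
Qed.

(** f composed with L(1) is L(-1) f, whose modes are derivatives. *)
Lemma coaction_derivative m p :
  tmap (voc_L V 1) idfun (ser (coaction^~ m) p) = dz (ser (coaction^~ m)) p.
Proof.
apply/eqP; rewrite -subr_eq0; apply/eqP/tensor_separated => f.
rewrite (linB (contractl_lin _)) /ser /dz (linZ (contractl_lin _)).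
rewrite (@contractl_map K V M V M (voc_L V 1) idfun f (@voa_L K U (-1) f : V')); last first.
  by move=> x; rewrite [RHS]dual_LE opprK.
rewrite -!/(comode coaction _ _ m) !comode_coaction (vm_derivative hU hR).
rewrite (_ : - (- p - 1) = p + 1); last lia.
by rewrite (_ : - p - 1 - 1 = - (p + 1) - 1) ?subrr //; lia.
Qed.

(** L(1) is the mode of index 0 of the conformal vector, and the commutator of
    that mode with f_k is a mode of L(-1) f. *)
Lemma coaction_commutator m p : let L1 := coL (voc_rho V) coaction 1 in
  dz (ser (coaction^~ m)) p
  = ser (coaction^~ (L1 m)) p - tmap idfun L1 (ser (coaction^~ m) p).
Proof.
move=> L1; apply/eqP; rewrite -subr_eq0; apply/eqP/tensor_separated => f.
rewrite !(linB (contractl_lin _)) /ser /dz (linZ (contractl_lin _)).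
rewrite (@contractl_map K V M V M idfun L1 f f) //.
rewrite -!/(comode coaction _ _ _) !comode_coaction /L1 !coaction_coL subrr.
have := vm_commutator_small hR 0 (@voa_omega K U) f m (- p - 1).
rewrite big_ord1 zbin0 scale1r /mode2 -[@voa_Y K U _ _ _]/(@voa_L K U (-1) f).
rewrite (vm_derivative hU hR) => ->; apply/eqP; rewrite subr_eq0; apply/eqP.
by congr (_%:~R *: R _ f m); rewrite /=; lia.
Qed.

Lemma coaction_admissible : admissible_comodule coaction.
Proof.
split; last by exists B; split=> // k t m; exact: coaction_graded.
split.
- exact: coaction_truncated.
- by move=> m k; rewrite -comode_vacuum comode_coaction (vm_vacuum hR).
- exact: coaction_jacobi.
- exact: coaction_virasoro.
- exact: coaction_derivative.
- exact: coaction_commutator.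
Qed.

End Bases.
End ModuleToComodule.

(** * Equality of the two semisimplicity conditions *)

Section TwistNatural.
Context (K : numFieldType) (U : voa_data K) (hU : is_voa U) (M N : lmodType K).
Context (c : bool) (Z : int -> U -> M -> M) (Z' : int -> U -> N -> N).
Hypotheses (hZ : vmodes c Z) (hZ' : vmodes c Z').

Lemma twist_natural (iota : {linear N -> M}) :
  (forall k u n, Z k u (iota n) = iota (Z' k u n)) ->
  forall k u n, twist Z k u (iota n) = iota (twist Z' k u n).
Proof.
move=> nat k u n; move: u; apply: (linear_eq_homog (voa_direct_sum hU)).
- exact: (twist_linl hU hZ).
- by move=> a u v; rewrite (twist_linl hU hZ') linearP.
move=> r a ra; have [J HJ] := divpow_eventually0 hU a.
rewrite (twist_sum hU hZ _ _ ra HJ) (twist_sum hU hZ' _ _ ra HJ).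
rewrite (linZ (linearP iota)) (lin_sum (linearP iota)).
by congr (_ *: _); apply: eq_bigr => j _; rewrite nat.
Qed.

End TwistNatural.

Section Correspondence.
Context (K : numFieldType) (V : gvoc K).
Local Notation V' := (gdual (voc_gr V)).
Local Notation U := (dual_voa V).
Implicit Types M N : lmodType K.
Let hU := dual_is_voa V.

(** Both directions of the exchange are recorded, since intertwining maps are
    transported both ways. *)
Definition corresponds M (DeltaM : int -> {linear M -> tensor V M})
    (YM : int -> U -> M -> M) : Prop :=
  [/\ vmodes false (comode DeltaM : int -> U -> M -> M), vmodes true YM,
      forall k f m, comode DeltaM k f m = twist YM k f m
    & forall k f m, YM k f m = twist (comode DeltaM : int -> U -> M -> M) k f m].

Lemma module_of_comodule M (DeltaM : int -> {linear M -> tensor V M}) :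
  admissible_comodule DeltaM ->
  exists YM : int -> U -> M -> M, admissible_module YM /\ corresponds DeltaM YM.
Proof.
move=> adm; exists (twist (comode DeltaM : int -> U -> M -> M)).
have hc := comode_modes adm.1; split; first exact: admissible_module_of_comodule.
split=> //; first exact: (twist_modes hU hc).
by move=> k f m; rewrite (twistK hU hc).
Qed.

Lemma comodule_of_module M (YM : int -> U -> M -> M) : admissible_module YM ->
  exists DeltaM : int -> {linear M -> tensor V M},
    admissible_comodule DeltaM /\ corresponds DeltaM YM.
Proof.
move=> [/weak_moduleP hY [B [hB gB]]].
have hR : vmodes false (twist YM) := twist_modes hU hY.
have gR r k s f m : @gdual_gr K V (voc_gr V) r f -> B s m ->
    int_ext B (s%:Z + (k + 1 - r)) (twist YM k f m).
  move=> fr sm; have := twist_graded hU hY hB.1.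
  apply=> // r' t s' v w vr sw.
  rewrite (_ : s'%:Z + (r' - t - 1) = r' + s'%:Z - t - 1); last lia.
  exact: gB.
have [n [e [eps be]]] := dual_bases V.
have cE := comode_coaction hR hB gR be.
exists (coaction hR hB gR be); split; first exact: coaction_admissible.
have cE' : comode (coaction hR hB gR be) = twist YM.
  by apply/funext => k; apply/funext => f; apply/funext => m; exact: cE.
split=> //; first by rewrite cE'.
by move=> k f m; rewrite cE' (twistK hU hY).
Qed.

(** A linear map commutes with the coactions if and only if it commutes with the
    actions: each is a fixed formula in the other, and contractions separate
    tensors. *)
Lemma subcomoduleP M DeltaM (YM : int -> U -> M -> M) N DeltaN (YN : int -> U -> N -> N) W :
  corresponds DeltaM YM -> corresponds DeltaN YN ->
  is_subcomodule DeltaM W DeltaN <-> is_submodule YM W YN.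
Proof.
move=> [cM vM cYM YcM] [cN vN cYN YcN].
split=> -[iota [inj ran nat]]; exists iota; split=> // k.
  move=> u n; rewrite YcM YcN; apply: (twist_natural hU cM cN) => k' f m.
  by rewrite /comode nat (contractl_map _ _ (g := f : V')).
move=> n; apply/eqP; rewrite -subr_eq0; apply/eqP/tensor_separated => f.
rewrite (linB (contractl_lin _)) (contractl_map _ _ (g := f)) //.
rewrite -!/(comode _ _ _ _) cYM cYN (twist_natural hU vM vN) ?subrr //.
Qed.

(** The grading of a subobject is its own, so it has to be transported by the
    two constructions on the subobject itself. *)
Lemma admissible_subcomoduleP M DeltaM (YM : int -> U -> M -> M) W :
  corresponds DeltaM YM ->
  admissible_subcomodule DeltaM W <-> admissible_submodule YM W.
Proof.
move=> cM; split=> [[N [DeltaN [aN sN]]]|[N [YN [aN sN]]]].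
  have [YN [aYN cN]] := module_of_comodule aN.
  by exists N, YN; split=> //; apply/(subcomoduleP W cM cN).
have [DeltaN [aDN cN]] := comodule_of_module aN.
by exists N, DeltaN; split=> //; apply/(subcomoduleP W cM cN).
Qed.

Lemma simple_comoduleP M DeltaM (YM : int -> U -> M -> M) :
  corresponds DeltaM YM -> simple_comodule DeltaM <-> irreducible_module YM.
Proof.
move=> cM; split=> -[M0 sub]; split=> // W.
  by move=> /(admissible_subcomoduleP W cM)/sub.
by move=> /(admissible_subcomoduleP W cM)/sub.
Qed.

Lemma cosemisimpleP M DeltaM (YM : int -> U -> M -> M) :
  corresponds DeltaM YM -> cosemisimple DeltaM <-> completely_reducible YM.
Proof.
move=> cM; split=> -[I [W [dW sW]]]; exists I, W; split=> // i.
  have [N [DeltaN [aN simN subN]]] := sW i.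
  have [YN [aYN cN]] := module_of_comodule aN.
  exists N, YN; split=> //; first exact/(simple_comoduleP cN).
  exact/(subcomoduleP _ cM cN).
have [N [YN [aN simN subN]]] := sW i.
have [DeltaN [aDN cN]] := comodule_of_module aN.
exists N, DeltaN; split=> //; first exact/(simple_comoduleP cN).
exact/(subcomoduleP _ cM cN).
Qed.

Lemma corational_iff_rational : corational V <-> rational_voa (dual_voa V).
Proof.
split=> [cor|[_ rat] M DeltaM aM].
  split; first exact: dual_is_voa.
  move=> M YM aM; have [DeltaM [aDM cM]] := comodule_of_module aM.
  exact/(cosemisimpleP cM)/cor.
have [YM [aYM cM]] := module_of_comodule aM.
exact/(cosemisimpleP cM)/rat.
Qed.

End Correspondence.

Theorem theorem7p9 (R : realType) (V : gvoc R[i])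
    (hc : ~ (voc_gr V 0 `<=` [set v | voc_counit V v = 0]))
    (hrho : ~ (voc_gr V 2 `<=` [set v | voc_rho V v = 0]))
    (hA : forall k : nat, findim [set: zhu (dual_voa V) k]) :
  corational V <-> rational_voa (dual_voa V).
Proof. exact: corational_iff_rational. Qed.
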